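(* Let $\Omega=(a,b)\subset\mathbb{R}$ be a bounded open interval, and let $I_1,\dots,I_N$ be disjoint intervals, indexed from left to right, with $\bigcup_{i=1}^N I_i=\Omega$. Let $$f_0(x)=\sum_{i=1}^N f_i\,\mathcal{X}_{I_i}(x),\quad x\in\Omega,$$ with $f_i\in\mathbb{R}$ and $f_i\neq f_j$ for $i\neq j$, and let $\eta\in BV(\Omega)$ satisfy $\int_{I_i}\eta\,dx=0$ for all $i=1,\dots,N$. Let $f=f_0+\eta\in BV(\Omega)$. Let $\alpha$ be a continuous piecewise affine function on $\overline\Omega$ such that (i) $\alpha(x_i)=0$, where $x_i=\sup I_i$, for $i=1,\dots,N-1$; (ii) $\alpha\ge0$, and in every interval $I_i$ it is of the form $\alpha(x)=-\mu_i|x-c_i|+d_i$ with $\mu_i>2\|f\|_\infty$, for every $i=1,\dots,N$. Then $$f_0=\operatorname*{argmin}_{u\in BV(\Omega)}\ \frac12\int_\Omega (f-u)^2\,dx+\int_\Omega\alpha(x)\,d|Du|.$$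
   Context: $\mathcal{X}_A$ denotes the characteristic function of the set $A$; intervals are non-degenerate; $\|f\|_\infty$ is the $L^\infty(\Omega)$ norm; $|Du|$ is the total variation measure of the distributional derivative $Du$. The minimisation problem with continuous $\alpha\ge0$ and $f\in BV(\Omega)$ has a unique solution; equality is up to Lebesgue-null sets. *)

(* Defs.v *)
From HB Require Import structures.
From mathcomp Require Import all_boot all_order all_algebra.
From mathcomp Require Import all_classical all_reals all_analysis.
Set Implicit Arguments.
Unset Strict Implicit.
Unset Printing Implicit Defensive.
Import Order.TTheory GRing.Theory Num.Theory.
Import numFieldNormedType.Exports.
Local Open Scope classical_set_scope.
Local Open Scope ring_scope.

Section BV.
Context {R : realType}.
Implicit Types (Omega : set R) (u f alpha phi : R -> R).

(* A finite signed Borel measure, in particular Du, is a charge on the Borel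
   sets of R; its positive and negative parts and its total variation are the
   library's, for some Hahn decomposition (they do not depend on which). *)
Lemma Hahn_pair (nu : {charge set (measurableTypeR R) -> \bar R}) :
  exists PN : set (measurableTypeR R) * set (measurableTypeR R),
    hahn_decomposition nu PN.1 PN.2.
Proof. by have [P [N nuPN]] := Hahn_decomposition nu; exists (P, N). Qed.

Definition charge_total_variation (nu : {charge set (measurableTypeR R) -> \bar R}) :
    {measure set (measurableTypeR R) -> \bar R} :=
  charge_variation (projT2 (cid (Hahn_pair nu))).

Definition charge_integral (nu : {charge set (measurableTypeR R) -> \bar R})
    Omega phi : R :=
  \int[jordan_pos (projT2 (cid (Hahn_pair nu)))]_(x in Omega) phi x -
  \int[jordan_neg (projT2 (cid (Hahn_pair nu)))]_(x in Omega) phi x.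

Definition test_function Omega phi : Prop :=
  [/\ forall (n : nat) (x : R), derivable (derive1n n phi) x 1,
      compact (closure [set x | phi x != 0]) &
      closure [set x | phi x != 0] `<=` Omega].

(* A measure on Omega is encoded as a measure on R that does not charge the
   complement of Omega. *)
Definition is_distr_derivative Omega u
    (nu : {charge set (measurableTypeR R) -> \bar R}) : Prop :=
  (forall A : set (measurableTypeR R), measurable A -> A `&` Omega = set0 -> nu A = 0%E) /\
  (forall phi, test_function Omega phi ->
     \int[lebesgue_measure]_(x in Omega) (u x * derive1 phi x) =
     - charge_integral nu Omega phi).

Definition BV Omega u : Prop :=
  lebesgue_measure.-integrable Omega (EFin \o u) /\
  exists nu, is_distr_derivative Omega u nu.

(* Du; the zero charge when u has no measure derivative. *)
Definition distr_derivative Omega u :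
    {charge set (measurableTypeR R) -> \bar R} :=
  match pselect (exists nu, is_distr_derivative Omega u nu) with
  | left h => projT1 (cid h)
  | right _ => czero
  end.

(* The norm of L^oo(Omega), computed on the extension by zero. *)
Definition Linfty_norm Omega u : \bar R :=
  'N[lebesgue_measure]_+oo[(EFin \o u) \_ Omega].

Definition energy Omega f alpha u : \bar R :=
  ((2^-1)%:E * \int[lebesgue_measure]_(x in Omega) ((f x - u x) ^+ 2)%:E +
   \int[charge_total_variation (distr_derivative Omega u)]_(x in Omega)
     (alpha x)%:E)%E.

Definition BV_argmin Omega (J : (R -> R) -> \bar R) : set (R -> R) :=
  [set u | BV Omega u /\ forall v, BV Omega v -> (J u <= J v)%E].

Definition step_function (N : nat) (I : 'I_N -> set R) (v : 'I_N -> R) : R -> R :=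
  fun x => \sum_(i < N) v i * \1_(I i) x.

Definition piecewise_affine (a b : R) alpha : Prop :=
  exists2 s : seq R, itv_partition a b s &
    forall k : nat, (k < size s)%N -> exists p q : R,
      forall x, nth b (a :: s) k < x < nth b (a :: s) k.+1 ->
        alpha x = p * x + q.

End BV.

(* Main.v *)
(** Put H y = \int_[y, b[ eta.  Since f_i is the mean of f on I_i, |eta| <= 2 ||f||
    almost everywhere; as eta has mean zero on each I_i, H y is also, up to sign,
    the integral of eta over either side of y in I_i.  If t = alpha y / mu_i, then
    alpha >= 0 and the slope of alpha force one of the two sides of y in I_i to have
    length at most t, so that |H| <= alpha.  Integrating by parts, for every u in BV,
      \int eta u = \int H dDu <= \int alpha d|Du|,
    and expanding (f - u)^2 = (eta - (u - f_0))^2 with \int eta f_0 = 0 gives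
      J u >= 1/2 \int eta^2 + 1/2 \int (u - f_0)^2,
    while J f_0 = 1/2 \int eta^2 because Df_0 lives on the zeros x_i of alpha.
    The integration by parts rests on u x = Du(]a, x]) + C almost everywhere, which
    is Fubini's theorem and the du Bois-Reymond lemma. *)
Require Import Defs.
From HB Require Import structures.
From mathcomp Require Import all_boot all_order all_algebra.
From mathcomp Require Import all_classical all_reals all_analysis.
From mathcomp Require Import measurable_realfun ess_sup_inf.
From mathcomp Require Import ring lra.
Set Implicit Arguments.
Unset Strict Implicit.
Unset Printing Implicit Defensive.
Import Order.TTheory GRing.Theory Num.Theory.
Import numFieldNormedType.Exports.
Local Open Scope classical_set_scope.
Local Open Scope ring_scope.

(** * Smooth cutoff functions *)

(** The tail integral H is a dual certificate for f_0: H' = - eta = f_0 - f almost everywhere and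
    |H| <= alpha. The term 1/2 \int (u - f_0)^2 left over in the lower bound is what forces
    uniqueness. The work lies in making the pairing of H with Du legitimate: the definition of Du
    speaks only of smooth functions with compact support, whereas H is just the integral of a BV
    function, and both [distr_derivative] and the Jordan parts of a charge are obtained by choice.
    Facts about Du are therefore proved for every charge that satisfies the definition. Two families
    of test functions, both made from exp(-1/x), carry the argument: differences of smooth steps,
    whose derivatives concentrate at two points, and plateaus, which converge to the indicator of an
    open interval. The former recover u from Du, the latter show that |Du| vanishes on open
    intervals where u is constant. *)

Section smooth_step.
Context {R : realType}.
Implicit Types (f g : R -> R).

(** The classical flat function exp(-1/x), together with the negative powers of x that
    differentiation brings in. *)
Definition flat (n : nat) (x : R) : R :=
  if 0 < x then x ^- n * expR (- x^-1) else 0.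

(** The term of degree n + 2 in the exponential series at 1/x bounds exp(-1/x) by (n + 2)! x^(n +
    2). After multiplication by x^-n a square is left, one power more than the difference quotient
    at 0 consumes. *)
Lemma flat_le (n : nat) (x : R) : 0 < x -> flat n x <= n.+2`!%:R * x ^+ 2.
Proof.
move=> x0; rewrite /flat x0 expRN.
have x'0 : 0 < x^-1 by rewrite invr_gt0.
have := expR_ge1Dxn n.+1 (ltW x'0); rewrite exprVn => h.
have xn0 : 0 < x ^+ n by rewrite exprn_gt0.
have e0 := expR_gt0 x^-1.
have f0 : 0 < (n.+2`!)%:R :> R by rewrite ltr0n fact_gt0.
rewrite ler_pdivrMr // -ler_pdivrMl //; last by rewrite mulr_gt0 // exprn_gt0.
apply: le_trans (le_trans _ h); last by [].
rewrite -[leLHS]add0r lerD // le_eqVlt; apply/orP; left; apply/eqP.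
rewrite -addn2 exprD; field.
by rewrite ?gt_eqF ?exprn_gt0.
Qed.

Lemma is_derive_flat (n : nat) (x : R) :
  is_derive x 1 (flat n) (flat n.+2 x - n%:R * flat n.+1 x).
Proof.
have [x0|x0|->] := ltgtP x 0.
- have F m y : y < 0 -> flat m y = 0 by move=> y0; rewrite /flat ltNge ltW.
  rewrite (F n.+2 x x0) (F n.+1 x x0) mulr0 subr0; apply: (near_eq_is_derive (f := cst 0)).
    near=> y; rewrite /= F//.
    by near: y; exact: lt_nbhsl.
- rewrite /flat x0.
  apply: (near_eq_is_derive
    (f := ((fun y : R => y^-1) ^+ n * (expR \o (fun y => - y^-1))))).
    near=> y; rewrite /= /flat ifT //.
      by rewrite !fctE exprVn.
    by near: y; exact: lt_nbhsr.
  have xN0 : x != 0 by rewrite gt_eqF.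
  have ? : is_derive x 1 (fun y : R => y^-1) (- x ^- 2).
    by apply: is_derive_eq; first exact: is_deriveV; rewrite scaler1.
  apply: is_derive_eq; rewrite !fctE /= /GRing.scale /=; move: (expR _) => E.
  case: n => [|n].
    by rewrite !expr0 !mul0r mulr0 addr0 subr0 opprK mul1r mulrC.
  rewrite /= !exprVn !exprS; field.
  by rewrite xN0 expf_neq0.
- have F m : flat m 0 = 0 by rewrite /flat ltxx.
  rewrite !F mulr0 subr0.
  (* At 0 only positive increments contribute, and there [flat_le] bounds the quotient by (n + 2)!
     h. *)
  have C : (fun h : R => h^-1 *: (flat n (h *: 1 + 0) - flat n 0)) @ 0^' --> (0 : R).
    apply/cvgr0Pnorm_le => e e0; near=> h.
    rewrite /GRing.scale /= mulr1 addr0 {2}/flat ltxx subr0.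
    have [h0|h0] := ltP 0 h; last first.
      by rewrite /flat ltNge h0 mulr0 normr0 ltW.
    have fge0 : 0 <= flat n h by rewrite /flat h0 mulr_ge0 ?expR_ge0// invr_ge0 exprn_ge0// ltW.
    rewrite ger0_norm ?mulr_ge0 ?invr_ge0 ?(ltW h0)//.
    rewrite ler_pdivrMl//; apply: le_trans (flat_le n h0) _.
    rewrite expr2 mulrCA ler_pM2l//.
    have: `|h| <= e / n.+2`!%:R.
      near: h; apply: dnbhs0_le; rewrite divr_gt0// ltr0n fact_gt0//.
    rewrite gtr0_norm// ler_pdivlMr ?ltr0n ?fact_gt0// mulrC; exact.
  apply: DeriveDef; first by apply/cvg_ex; exists 0.
  exact/cvg_lim.
Unshelve. all: by end_near. Qed.

Lemma is_derive_comp_affine f (p q x df : R) :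
  is_derive (p * x + q) 1 f df ->
  is_derive x 1 (fun x => f (p * x + q)) (p * df).
Proof.
move=> dfx; have dpq : is_derive x 1 (fun x : R => p * x + q) p.
  have -> : (fun x : R => p * x + q) = p *: (@id R) + cst q by [].
  by apply: is_derive_eq; rewrite addr0 /GRing.scale /= mulr1.
rewrite mulrC.
exact: (@is_derive1_comp R f (fun x => p * x + q) x _ _ dfx dpq).
Qed.

(* Every generator has its derivative in the class, so that its members are smooth
   by induction. *)
Inductive smooth_alg : (R -> R) -> Prop :=
| smooth_flat n : smooth_alg (flat n)
| smooth_cst c : smooth_alg (cst c)
| smooth_affine f p q : smooth_alg f -> smooth_alg (fun x => f (p * x + q))
| smoothD f g : smooth_alg f -> smooth_alg g -> smooth_alg (fun x => f x + g x)
| smoothM f g : smooth_alg f -> smooth_alg g -> smooth_alg (fun x => f x * g x)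
| smoothV f : smooth_alg f -> (forall x, f x != 0) ->
    smooth_alg (fun x => (f x)^-1).

Lemma smooth_alg_derive f : smooth_alg f ->
  exists2 g, smooth_alg g & forall x : R, is_derive x 1 f (g x).
Proof.
elim=> {f} [n|c|f p q sf [g sg dg]|f g sf [f' sf' df] sg [g' sg' dg]
           |f g sf [f' sf' df] sg [g' sg' dg]|f sf [f' sf' df] f0].
- exists (fun x => flat n.+2 x + cst (- n%:R) x * flat n.+1 x).
    apply: smoothD; first exact: smooth_flat.
    by apply: smoothM; [exact: smooth_cst|exact: smooth_flat].
  by move=> x; apply: is_derive_eq; [exact: is_derive_flat|rewrite mulNr].
- by exists (cst 0); [exact: smooth_cst|move=> x; exact: is_derive_cst].
- exists (fun x => cst p x * g (p * x + q)).
    by apply: smoothM; [exact: smooth_cst|exact: smooth_affine].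
  by move=> x; exact: is_derive_comp_affine.
- exists (fun x => f' x + g' x); first exact: smoothD.
  by move=> x; exact: is_deriveD.
- exists (fun x => f x * g' x + g x * f' x).
    by apply: smoothD; exact: smoothM.
  by move=> x; exact: is_deriveM.
- exists (fun x => cst (-1) x * ((f x)^-1 * (f x)^-1) * f' x).
    apply: smoothM => //; apply: smoothM; first exact: smooth_cst.
    by apply: smoothM; exact: smoothV.
  move=> x; apply: is_derive_eq (is_deriveV (f0 x) (df x)) _.
  by rewrite /GRing.scale /= mulN1r -invfM expr2.
Qed.

Lemma smooth_alg_derive1 f : smooth_alg f -> smooth_alg (derive1 f).
Proof.
move=> /smooth_alg_derive [g sg dg]; rewrite (_ : (derive1 f) = g)//.
by apply/funext => x; rewrite derive1E; exact: derive_val.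
Qed.

Lemma smooth_alg_derivable f x : smooth_alg f -> derivable f x 1.
Proof. by move=> /smooth_alg_derive [g sg dg]; exact: ex_derive. Qed.

Lemma smooth_alg_derivable_n f n x : smooth_alg f -> derivable (derive1n n f) x 1.
Proof.
move=> sf; apply: smooth_alg_derivable; elim: n => [//|n ih].
by rewrite derive1nS; exact: smooth_alg_derive1.
Qed.

Lemma smooth_alg_continuous f : smooth_alg f -> continuous f.
Proof.
move=> sf x; apply: differentiable_continuous.
by apply/derivable1_diffP; exact: smooth_alg_derivable.
Qed.

Lemma smoothB f g : smooth_alg f -> smooth_alg g -> smooth_alg (fun x => f x - g x).
Proof.
move=> sf sg; rewrite (_ : (fun _ => _) = fun x => f x + cst (-1) x * g x); last first.
  by apply/funext => x; rewrite mulN1r.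
by apply: smoothD => //; apply: smoothM => //; exact: smooth_cst.
Qed.

Lemma flat0_ge0 x : 0 <= flat 0 x.
Proof. by rewrite /flat; case: ifP => // _; rewrite expr0 invr1 mul1r expR_ge0. Qed.

Lemma flat0_gt0 x : 0 < x -> 0 < flat 0 x.
Proof. by rewrite /flat => ->; rewrite expr0 invr1 mul1r expR_gt0. Qed.

Lemma flat_le0 n x : x <= 0 -> flat n x = 0.
Proof. by rewrite /flat ltNge => ->. Qed.

(** The denominator never vanishes, since x and 1 - x are not both nonpositive. The form -1 * x + 1
    is the one that [smooth_affine] accepts. *)
Definition smooth_step (x : R) : R :=
  flat 0 x * (flat 0 x + flat 0 (-1 * x + 1))^-1.

Let den_gt0 x : 0 < flat 0 x + flat 0 (-1 * x + 1).
Proof.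
have [x0|x0] := ltP 0 x; first by rewrite ltr_pwDl ?flat0_ge0 ?flat0_gt0.
by rewrite ltr_wpDl ?flat0_ge0// flat0_gt0//; lra.
Qed.

Lemma smooth_step_smooth : smooth_alg smooth_step.
Proof.
apply: smoothM; first exact: smooth_flat.
apply: smoothV => [|x]; last by rewrite gt_eqF.
by apply: smoothD; [exact: smooth_flat|apply: smooth_affine; exact: smooth_flat].
Qed.

Lemma smooth_step_le0 x : x <= 0 -> smooth_step x = 0.
Proof. by move=> x0; rewrite /smooth_step flat_le0 ?mul0r. Qed.

Lemma smooth_step_ge1 x : 1 <= x -> smooth_step x = 1.
Proof.
move=> x1; rewrite /smooth_step [flat 0 (_ + _)]flat_le0 ?addr0; last by lra.
by rewrite divff// gt_eqF// flat0_gt0//; lra.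
Qed.

Lemma smooth_step_ge0 x : 0 <= smooth_step x.
Proof. by rewrite /smooth_step mulr_ge0 ?invr_ge0 ?flat0_ge0//; exact: ltW. Qed.

Lemma smooth_step_le1 x : smooth_step x <= 1.
Proof. by rewrite /smooth_step ler_pdivrMr// mul1r lerDl flat0_ge0. Qed.

Lemma derive_smooth_step_out x : x \notin `[0, 1] -> derive1 smooth_step x = 0.
Proof.
rewrite in_itv /= negb_and -!ltNge => /orP x01; rewrite derive1E.
suff [c xc] : exists c : R, \forall y \near x, smooth_step y = cst c y.
  by rewrite (near_eq_derive _ xc) derive_cst.
case: x01 => x01.
- exists 0; near=> y; rewrite smooth_step_le0//; apply: ltW.
  by near: y; exact: lt_nbhsl.
- exists 1; near=> y; rewrite smooth_step_ge1//; apply: ltW.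
  by near: y; exact: lt_nbhsr.
Unshelve. all: by end_near. Qed.

Lemma derive_smooth_step_bounded :
  exists2 K, 0 < K & forall x, `|derive1 smooth_step x| <= K.
Proof.
have sS' := smooth_alg_derive1 smooth_step_smooth.
have [c _ cmax] : exists2 c, c \in `[(0:R), 1] & forall t, t \in `[(0:R), 1] ->
   `|derive1 smooth_step t| <= `|derive1 smooth_step c|.
  apply: EVT_max; first by lra.
  apply: continuous_subspaceT => x.
  by apply: cvg_norm; exact: smooth_alg_continuous.
(* The added 1 makes the bound positive; the mollification estimate divides by it. *)
exists (`|derive1 smooth_step c| + 1); first by rewrite ltr_wpDl.
move=> x; have [x01|x01] := boolP (x \in `[0, 1]).
  by rewrite (le_trans (cmax x x01))// lerDl.
by rewrite derive_smooth_step_out// normr0 addr_ge0.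
Qed.

End smooth_step.

(** * Integration against charges *)

Section charge_integrals.
Context {R : realType}.
Local Notation mR := (measurableTypeR R).
Implicit Types (nu : {charge set mR -> \bar R}) (m : {measure set mR -> \bar R}).
Implicit Types (D : set mR) (f g phi : mR -> R).

Lemma fin_num_fun_integrable m D f (K : R) : fin_num_fun m -> measurable D ->
  measurable_fun D f -> (forall x, D x -> `|f x| <= K) ->
  m.-integrable D (EFin \o f).
Proof.
move=> finm mD mf fK; apply: measurable_bounded_integrable => //.
  by rewrite -ge0_fin_numE//; exact: finm.
exists K; split=> [|M KM x Dx]; rewrite /= ?num_real//.
by rewrite (le_trans (fK x Dx))// ltW.
Qed.

Lemma Rintegral_measure_add m1 m2 D f (K : R) :
  fin_num_fun m1 -> fin_num_fun m2 -> measurable D ->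
  measurable_fun D f -> (forall x, D x -> `|f x| <= K) ->
  \int[measure_add m1 m2]_(x in D) f x =
  \int[m1]_(x in D) f x + \int[m2]_(x in D) f x.
Proof.
move=> fin1 fin2 mD mf fK.
have mEf : measurable_fun D (EFin \o f) by exact/measurable_EFinP.
have fI1 := fin_num_fun_integrable fin1 mD mf fK.
have fI2 := fin_num_fun_integrable fin2 mD mf fK.
rewrite /Rintegral integral_measure_add// fineD//; exact: integrable_fin_num.
Qed.

(** [charge_integral] uses a chosen Hahn decomposition, so concrete charges are integrated through
    this lemma. If nu = m1 - m2, then jordan_pos + m2 and m1 + jordan_neg are the same measure, and
    bounded functions integrate additively against sums of finite measures. *)
Lemma charge_integral_diff nu m1 m2 D f (K : R) :
  fin_num_fun m1 -> fin_num_fun m2 ->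
  measurable D -> (forall A, measurable A -> nu A = m1 A - m2 A)%E ->
  measurable_fun D f -> (forall x, D x -> `|f x| <= K) ->
  charge_integral nu D f = \int[m1]_(x in D) f x - \int[m2]_(x in D) f x.
Proof.
move=> fin1 fin2 mD nuE mf fK; rewrite /charge_integral.
set h := projT2 _.
have fp : fin_num_fun (jordan_pos h) by move=> A mA; exact: fin_num_measure.
have fn : fin_num_fun (jordan_neg h) by move=> A mA; exact: fin_num_measure.
have E : \int[measure_add (jordan_pos h) m2]_(x in D) f x =
         \int[measure_add m1 (jordan_neg h)]_(x in D) f x.
  congr fine; apply: eq_measure_integral => A mA _.
  rewrite [LHS]measure_addE [RHS]measure_addE.
  have := jordan_decomp h mA; rewrite /cadd /= cscaleN1 /= nuE//.
  move: (fp A mA) (fn A mA) (fin1 A mA) (fin2 A mA).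
  move=> /fineK <- /fineK <- /fineK <- /fineK <-.
  by rewrite -!EFinD => -[H]; congr EFin; lra.
move: E; do 2 rewrite (@Rintegral_measure_add _ _ D f K)//.
lra.
Qed.

Lemma charge_integral_add (n1 n2 : {charge set mR -> \bar R}) D f (K : R) :
  measurable D -> measurable_fun D f -> (forall x, D x -> `|f x| <= K) ->
  charge_integral (cadd n1 n2) D f = charge_integral n1 D f + charge_integral n2 D f.
Proof.
move=> mD mf fK.
set h1 := projT2 (cid (Hahn_pair n1)); set h2 := projT2 (cid (Hahn_pair n2)).
have fa (m m' : {finite_measure set mR -> \bar R}) : fin_num_fun (measure_add m m').
  by move=> A mA; rewrite measure_addE fin_numD !fin_num_measure.
rewrite (@charge_integral_diff _ (measure_add (jordan_pos h1) (jordan_pos h2))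
  (measure_add (jordan_neg h1) (jordan_neg h2)) _ _ K)//.
  do 2 (rewrite (@Rintegral_measure_add _ _ D f K)//;
    try by move=> A mA; exact: fin_num_measure).
  by rewrite /charge_integral -/h1 -/h2; lra.
- exact: (fa (jordan_pos h1) (jordan_pos h2)).
- exact: (fa (jordan_neg h1) (jordan_neg h2)).
move=> A mA; rewrite [X in (X - _)%E]measure_addE [X in (_ - X)%E]measure_addE /cadd /=.
rewrite -[LHS]/(n1 A + n2 A)%E (jordan_decomp h1 mA) (jordan_decomp h2 mA) /cadd /= !cscaleN1 /=.
have := fin_num_measure (jordan_pos h1) A mA.
have := fin_num_measure (jordan_neg h1) A mA.
have := fin_num_measure (jordan_pos h2) A mA.
have := fin_num_measure (jordan_neg h2) A mA.
move=> /fineK <- /fineK <- /fineK <- /fineK <-.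
by rewrite -!EFinD; congr EFin; lra.
Qed.

Definition cdirac (k x : R) : {charge set mR -> \bar R} :=
  cscale k (charge_of_finite_measure (dirac (x : mR))).

Lemma Rintegral_mscale_dirac (c : {nonneg R}) (x : R) D f :
  measurable D -> measurable_fun D f ->
  \int[mscale c (dirac (x : mR))]_(y in D) f y = c%:num * (\1_D x * f x).
Proof.
move=> mD mf; have mEf : measurable_fun D (EFin \o f) by exact/measurable_EFinP.
rewrite /Rintegral integralE !ge0_integral_mscale//;
  [|exact: measurable_funeneg|exact: measurable_funepos].
rewrite !integral_dirac//; [|exact: measurable_funeneg|exact: measurable_funepos].
rewrite diracE -indicE funeposE funenegE /= -!EFin_max -!EFinM -EFinB /=.
rewrite -!mulrBr; congr (_ * (_ * _)).
have [f0|/ltW f0] := leP 0 (f x).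
  by rewrite max_r ?oppr_le0// subr0.
by rewrite max_l ?oppr_ge0// sub0r opprK.
Qed.

Lemma charge_integral_cdirac (k x : R) D f (K : R) :
  measurable D -> measurable_fun D f -> (forall x, D x -> `|f x| <= K) ->
  charge_integral (cdirac k x) D f = k * (\1_D x * f x).
Proof.
move=> mD mf fK.
have fin0 : fin_num_fun (@mzero _ mR R) by move=> A mA.
have E (c : {nonneg R}) A : measurable A ->
    mscale c (dirac (x : mR)) A = (c%:num * \1_A x)%:E.
  by move=> mA; rewrite /mscale /= diracE indicE EFinM.
have fins (c : {nonneg R}) : fin_num_fun (mscale c (dirac (x : mR))).
  by move=> A mA; rewrite [X in X \is a fin_num](E c A mA).
(* [mscale] takes a nonnegative weight, so the sign of k decides whether the point mass forms the
   positive or the negative part. *)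
have [k0|k0] := leP 0 k.
- rewrite (@charge_integral_diff _ (mscale (NngNum k0) (dirac (x : mR))) mzero _ _ K)//.
    by rewrite Rintegral_mscale_dirac// /Rintegral integral_measure_zero subr0.
  move=> A mA; rewrite [X in (X - _)%E](E _ _ mA) sube0.
  by rewrite -[LHS]/(k%:E * dirac (x : mR) A)%E diracE -EFinM indicE.
- have k'0 : 0 <= - k by rewrite oppr_ge0 ltW.
  rewrite (@charge_integral_diff _ mzero (mscale (NngNum k'0) (dirac (x : mR))) _ _ K)//.
    by rewrite Rintegral_mscale_dirac// /Rintegral integral_measure_zero sub0r mulNr opprK.
  move=> A mA; rewrite [X in (_ - X)%E](E _ _ mA) sub0e -EFinN mulNr opprK.
  by rewrite -[LHS]/(k%:E * dirac (x : mR) A)%E diracE -EFinM indicE.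
Qed.

End charge_integrals.

(** * Test functions and BV *)

Section test_functions.
Context {R : realType}.
Local Notation mR := (measurableTypeR R).
Local Notation leb := (@lebesgue_measure R).
Implicit Types (a b : R) (phi u : R -> R).

Lemma derivable_continuous phi :
  (forall x : R, derivable phi x 1) -> continuous phi.
Proof.
by move=> dphi x; apply/differentiable_continuous/derivable1_diffP.
Qed.

Lemma Rintegral_derive1 phi (s t : R) : s <= t ->
  (forall x : R, derivable phi x 1) -> continuous (derive1 phi) ->
  \int[leb]_(x in `[s, t]) derive1 phi x = phi t - phi s.
Proof.
rewrite le_eqVlt => /predU1P[<- _ _|st dphi cphi'].
  by rewrite set_itv1 Rintegral_set1 subrr.
have cphi := derivable_continuous dphi.
have cphi'st : {within `[s, t], continuous (derive1 phi)} by exact: continuous_subspaceT.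
have dst : derivable_oo_LRcontinuous phi s t.
  split; first by move=> x _; exact: dphi.
    by apply: cvg_at_right_filter; exact: cphi.
  by apply: cvg_at_left_filter; exact: cphi.
by rewrite /Rintegral (continuous_FTC2 st cphi'st dst (fun=> fun=> erefl)).
Qed.

(** End points are null, and all four kinds of interval have to be covered because each I_i may or
    may not contain its ends. *)
Lemma Rintegral_itv_derive1 phi (s t : R) (c0 c1 : bool) : s <= t ->
  (forall x : R, derivable phi x 1) -> continuous (derive1 phi) ->
  \int[leb]_(x in [set` Interval (BSide c0 s) (BSide c1 t)]) derive1 phi x =
  phi t - phi s.
Proof.
move=> st dphi cphi'; rewrite -Rintegral_derive1//; congr fine.
have mphi' : measurable_fun (`]s, t[ : set R) (EFin \o derive1 phi).
  by apply/measurable_EFinP/measurable_funTS; exact: continuous_measurable_fun.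
by rewrite [LHS]integral_itv_bndoo// [RHS]integral_itv_bndoo.
Qed.

Section fixed_interval.
Variables (a b : R) (phi : R -> R).
Hypotheses (ab : a < b) (tphi : test_function `]a, b[%classic phi).

Lemma test_function_derivable (x : R) : derivable phi x 1.
Proof. by case: tphi => /(_ 0%N x). Qed.

Lemma test_function_continuous : continuous phi.
Proof. exact: derivable_continuous test_function_derivable. Qed.

Lemma test_function_derive1_continuous : continuous (derive1 phi).
Proof. by apply: derivable_continuous => x; case: tphi => /(_ 1%N x). Qed.

Lemma test_function_out (x : R) : ~ `]a, b[%classic x -> phi x = 0.
Proof.
move=> nx; apply/eqP/negP => /negP phix; apply: nx.
by case: tphi => _ _; apply; exact: subset_closure.
Qed.

Lemma continuous_itv_bounded (g : R -> R) : continuous g ->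
  exists K : R, forall x, `]a, b[%classic x -> `|g x| <= K.
Proof.
move=> cg; have [c _ cmax] : exists2 c, c \in `[a, b] & forall t, t \in `[a, b] ->
   `|g t| <= `|g c|.
  apply: EVT_max; first exact: ltW.
  by apply: continuous_subspaceT => x; apply: cvg_norm; exact: cg.
exists `|g c| => x; rewrite /= in_itv /= => /andP[ax xb].
by apply: cmax; rewrite in_itv /= !ltW.
Qed.

Lemma Rintegral_test_derive1 (y : R) : a < y < b ->
  \int[leb]_(x in `[y, b[) derive1 phi x = - phi y.
Proof.
move=> /andP[ay yb]; rewrite Rintegral_itv_derive1 ?(ltW yb)//; last 2 first.
- exact: test_function_derivable.
- exact: test_function_derive1_continuous.
by rewrite (@test_function_out b) ?sub0r//= in_itv/= ltxx andbF.
Qed.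

End fixed_interval.

Lemma integrable_mul_bounded (D : set mR) (m : {measure set mR -> \bar R})
    (u g : mR -> R) (K : R) :
  measurable D -> m.-integrable D (EFin \o u) -> measurable_fun D g ->
  (forall x, D x -> `|g x| <= K) -> m.-integrable D (EFin \o (fun x => u x * g x)).
Proof.
move=> mD iu mg gK; rewrite (_ : _ \o _ = (EFin \o u) \* (EFin \o g))%E//.
apply: integrableMl => //.
exists K; split=> [|M KM x Dx]; rewrite /= ?num_real//.
by rewrite (le_trans (gK x Dx))// ltW.
Qed.

Lemma continuous_measurable_itv (D : set R) (g : R -> R) : continuous g ->
  measurable_fun D g.
Proof. by move=> cg; apply: measurable_funTS; exact: continuous_measurable_fun. Qed.

Lemma BV_add a b u v : a < b -> BV `]a, b[%classic u -> BV `]a, b[%classic v ->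
  BV `]a, b[%classic (fun x => u x + v x).
Proof.
move=> ab [iu [n1 [n1O n1P]]] [iv [n2 [n2O n2P]]].
split; first exact: (integrableD _ iu iv).
exists (cadd n1 n2); split=> [A mA AO|phi tphi].
  by rewrite -[LHS]/(n1 A + n2 A)%E n1O// n2O// add0e.
have [K phiK] := continuous_itv_bounded ab (test_function_continuous tphi).
have [K' phi'K] := continuous_itv_bounded ab (test_function_derive1_continuous tphi).
have mphi' : measurable_fun (`]a, b[ : set R) (derive1 phi).
  by apply: continuous_measurable_itv; exact: (test_function_derive1_continuous tphi).
have mphi : measurable_fun (`]a, b[ : set R) phi.
  by apply: continuous_measurable_itv; exact: (test_function_continuous tphi).
rewrite (@charge_integral_add _ _ _ _ _ K)// opprD -n1P// -n2P//.
rewrite -RintegralD//; last 2 first.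
- exact: integrable_mul_bounded phi'K.
- exact: integrable_mul_bounded phi'K.
by apply: eq_Rintegral => x _; rewrite mulrDl.
Qed.

Lemma bounded_interval_itv (J : set R) a b : is_interval J -> J `<=` `]a, b[%classic ->
  exists c0 c1, J = [set` Interval (BSide c0 (inf J)) (BSide c1 (sup J))].
Proof.
move=> /is_intervalP JE Jab.
have lJ : has_lbound J.
  by exists a => x /Jab /=; rewrite in_itv /= => /andP[/ltW].
have uJ : has_ubound J.
  by exists b => x /Jab /=; rewrite in_itv /= => /andP[_ /ltW].
move: JE; rewrite /Rhull (asboolT lJ) (asboolT uJ) => JE.
(* [BSide true] closes an interval on the left but opens it on the right, hence the negation. *)
by exists `[< J (inf J) >], (~~ `[< J (sup J) >]).
Qed.

Lemma integrable_itv_bounded a b (u : mR -> R) (K : R) :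
  measurable_fun (`]a, b[ : set mR) u -> (forall x, `]a, b[%classic x -> `|u x| <= K) ->
  leb.-integrable (`]a, b[ : set mR) (EFin \o u).
Proof.
move=> mu uK; apply: measurable_bounded_integrable => //.
  by rewrite /= lebesgue_measure_itv /=; case: ifP => // _; rewrite -EFinB ltry.
exists K; split=> [|M KM x Ox]; rewrite /= ?num_real//.
by rewrite (le_trans (uK x Ox))// ltW.
Qed.

Lemma BV_indic a b (J : set R) (k : R) : a < b -> is_interval J -> J !=set0 ->
  J `<=` `]a, b[%classic -> BV `]a, b[%classic (fun x => k * \1_J x).
Proof.
move=> ab iJ [x0 Jx0] Jab; have mJ := is_interval_measurable iJ.
have m1 D : measurable_fun D (\1_J : R -> R) by exact: measurable_indic.
have itv1 : leb.-integrable (`]a, b[ : set R) (EFin \o (\1_J : R -> R)).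
  apply: (integrable_itv_bounded (K := 1)) => // x _.
  by rewrite indicE ger0_norm// lern1 leq_b1.
split; first exact: (integrableZl _ k itv1).
set l := inf J; set r := sup J; set O := `]a, b[%classic.
(* The derivative is k at inf J minus k at sup J. The factors [\1_O] delete an end of J that is also
   an end of Omega, since the charge must vanish off Omega; test functions vanish there, so they do
   not see the difference. *)
exists (cadd (cdirac (k * \1_O l) l) (cdirac (- k * \1_O r) r)); split=> [A mA AO|phi tphi].
  rewrite -[LHS]/((k * \1_O l)%:E * dirac (l : mR) A +
    (- k * \1_O r)%:E * dirac (r : mR) A)%E.
  rewrite !diracE -!EFinM -EFinD.
  have F x : \1_O x * (x \in (A : set R))%:R = 0 :> R.
    rewrite indicE -natrM mulnb -in_setI setIC AO in_set0//.
  by rewrite -!mulrA !F !mulr0 addr0.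
have [K phiK] := continuous_itv_bounded ab (test_function_continuous tphi).
have [K' phi'K] := continuous_itv_bounded ab (test_function_derive1_continuous tphi).
have mphi' : measurable_fun (`]a, b[ : set R) (derive1 phi).
  by apply: continuous_measurable_itv; exact: (test_function_derive1_continuous tphi).
have mphi : measurable_fun (`]a, b[ : set R) phi.
  by apply: continuous_measurable_itv; exact: (test_function_continuous tphi).
have mO : measurable O by exact: measurable_itv.
rewrite (@charge_integral_add _ _ _ _ _ K)//.
rewrite !(charge_integral_cdirac _ _ mO mphi phiK).
have F x : \1_O x * phi x = phi x.
  rewrite indicE; case: (boolP (x \in O)); rewrite ?mul1r// => /negP xO.
  by rewrite mul0r (test_function_out tphi)//; apply: contra_not xO => /mem_set.
rewrite -!mulrA !F.
have iphi' : leb.-integrable (`]a, b[ : set R) (EFin \o derive1 phi).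
  exact: integrable_itv_bounded phi'K.
have iJphi' : leb.-integrable (`]a, b[ : set R) (EFin \o (fun x => \1_J x * derive1 phi x)).
  exact: integrable_mul_bounded itv1 mphi' phi'K.
under eq_Rintegral do rewrite -mulrA.
rewrite RintegralZl//.
have -> : \int[leb]_(x in `]a, b[) (\1_J x * derive1 phi x) =
          \int[leb]_(x in J) derive1 phi x.
  rewrite -[in RHS](setIidr Jab) Rintegral_mkcondr; apply: eq_Rintegral => x _.
  by rewrite patchE indicE; case: (x \in J); rewrite ?mul1r ?mul0r.
have lr : l <= r.
  apply: (@le_trans _ _ x0).
    by apply: ge_inf => //; exists a => x /Jab /=; rewrite in_itv /= => /andP[/ltW].
  by apply: ub_le_sup => //; exists b => x /Jab /=; rewrite in_itv /= => /andP[_ /ltW].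
have [c0 [c1 JE]] := bounded_interval_itv iJ Jab.
rewrite [in LHS]JE Rintegral_itv_derive1//.
- lra.
- exact: test_function_derivable tphi.
- exact: test_function_derive1_continuous tphi.
Qed.

End test_functions.

(** * Fubini and cumulative functions of charges *)

Section fubini_cumulative.
Context {R : realType}.
Local Notation mR := (measurableTypeR R).
Local Notation leb := (@lebesgue_measure R).

Section finite_measure.
Variables (m : {finite_measure set mR -> \bar R}) (a b : R) (g : mR -> R).
Let O : set mR := `]a, b[%classic.
Hypothesis ig : leb.-integrable O (EFin \o g).

(** Points are pairs (y, x), with y the variable of m and x that of Lebesgue measure. The section of
    E at x in O is the ray up to x inside O; its section at y in O, cut to O, is [y, b[. The two
    iterated integrals of [h] thus yield the cumulative function and the tail integral. *)
Let E : set (mR * mR) := [set z | O z.1 /\ z.1 <= z.2].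
Let gO : mR -> R := g \_ O.
Let h (z : mR * mR) : R := gO z.2 * \1_E z.

Let mO : measurable O. Proof. exact: measurable_itv. Qed.

Let mE : measurable E.
Proof.
rewrite (_ : E = (fst @^-1` O) `&` [set z | z.1 <= z.2]); last by [].
apply: measurableI.
  by rewrite -[X in measurable X]setTI; exact: measurable_fst.
rewrite (_ : [set z | _] = setT `&` (fun z : mR * mR => z.1 <= z.2) @^-1` [set true]).
  by apply: measurable_fun_ler.
by rewrite setTI; apply/seteqP; split.
Qed.

Let mgO : measurable_fun setT gO.
Proof.
have mg : measurable_fun O g by apply/measurable_EFinP; exact: measurable_int ig.
by have := (measurable_restrictT g mO).1 mg.
Qed.

Let igO : leb.-integrable setT (EFin \o gO).
Proof. by rewrite /gO -restrict_EFin; exact: (integrable_mkcond _ mO).1 ig. Qed.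

Let mh : measurable_fun setT h.
Proof.
apply: measurable_funM; last exact: measurable_indic.
by apply: measurableT_comp => //; exact: measurable_snd.
Qed.

(** k is the norm when integrability of [h] is proved and the identity when Fubini is applied. *)
Let hx (x : mR) (k : R -> R) : k 0 = 0 ->
  (\int[m]_y (k (h (y, x)))%:E = (k (gO x))%:E * m (O `&` `]-oo, x]))%E.
Proof.
move=> k0; rewrite (_ : (fun y => (k (h (y, x)))%:E) =
  (fun y : mR => ((k (gO x)) * \1_(O `&` `]-oo, x]) y)%:E)); last first.
  apply/funext => y; rewrite /h !indicE.
  have -> : (y \in O `&` `]-oo, x]) = ((y, x) \in E).
    by apply/idP/idP; rewrite !inE /E /O /= !in_itv.
  by case: (_ \in E); rewrite ?mulr1// !mulr0 k0.
have mI : measurable (O `&` `]-oo, x] : set mR) by exact: measurableI.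
under eq_integral do rewrite EFinM.
rewrite integralZl//; last exact: integrable_indic.
by rewrite integral_indic// setIT.
Qed.

Let ih : (m \x leb)%E.-integrable setT (EFin \o h).
Proof.
apply/integrable21ltyP; first exact/measurable_EFinP.
have -> : (\int[leb]_x \int[m]_y `|(EFin \o h) (y, x)| =
    \int[leb]_x ((`|gO x|)%:E * m (O `&` `]-oo, x])))%E.
  by apply: eq_integral => x _; rewrite -(@hx x Num.norm)// normr0.
have /integrableP[_ goo] := igO.
apply: (@le_lt_trans _ _ (\int[leb]_x (`|(EFin \o gO) x| * m setT))%E).
  apply: ge0_le_integral => //.
  - by move=> x _; rewrite mule_ge0.
  - rewrite [X in measurable_fun _ X](_ : _ = (fun x => \int[m]_y `|(EFin \o h) (y, x)|)%E).
      apply: (measurable_fun_fubini_tonelli_G (abse \o (EFin \o h))) => //=.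
      by apply: measurableT_comp => //; exact/measurable_EFinP.
    by apply/funext => x; rewrite -(@hx x Num.norm)// normr0.
  - apply: emeasurable_funM => //.
    by apply: measurableT_comp => //; exact/measurable_EFinP.
  - by move=> x _; rewrite lee_wpmul2l//= le_measure ?inE//; exact: measurableI.
rewrite ge0_integralZr//; last first.
  by apply: measurableT_comp => //; exact/measurable_EFinP.
rewrite muleC lte_mul_pinfty//; exact: fin_num_measure.
Qed.

Definition tail_integral (y : R) : R := \int[leb]_(x in `[y, b[) g x.

Let hy (y : mR) :
  (\int[leb]_x (EFin \o h) (y, x) = ((EFin \o tail_integral) \_ O) y)%E.
Proof.
rewrite patchE; case: ifPn => yO; last first.
  rewrite integral0_eq// => x _; rewrite /h /= indicE.
  case: (boolP ((y, x) \in E)); rewrite ?mulr0// inE => -[/mem_set]; by rewrite (negbTE yO).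
rewrite /= /tail_integral /Rintegral fineK; last first.
  apply: integrable_fin_num => //; apply: integrableS ig => // x /=.
  by move: yO; rewrite inE /O /= !in_itv /= => /andP[ay _] /andP[/(lt_le_trans ay) -> ->].
rewrite [RHS]integral_mkcond; apply: eq_integral => x _.
rewrite /h /= patchE indicE /gO patchE.
have -> : (x \in `[y, b[%classic) = (x \in O) && ((y, x) \in E).
  apply/idP/andP; rewrite !inE /E /O /= !in_itv /=.
    move: yO; rewrite inE /O /= in_itv /= => /andP[ay yb] /andP[yx xb].
    by rewrite (lt_le_trans ay yx) xb ay yb yx.
  by move=> [/andP[ax xb] [_ ->]].
by case: (x \in O); case: (_ \in E); rewrite /= ?mulr1 ?mulr0 ?mul0r.
Qed.

(** The tail integral is a partial integral of [h], so Fubini supplies measurability and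
    integrability together, for every finite measure. *)
Lemma integrable_tail_integral : m.-integrable O (EFin \o tail_integral).
Proof.
apply: (integrable_mkcond _ mO).2.
have -> : (EFin \o tail_integral) \_ O = fubini_F leb (EFin \o h).
  by apply/funext => y; rewrite /fubini_F hy.
exact: integrable_fubini_F.
Qed.

Lemma Rintegral_cumulative_mul :
  \int[leb]_(x in O) (fine (m (O `&` `]-oo, x])) * g x) =
  \int[m]_(y in O) tail_integral y.
Proof.
rewrite /Rintegral [X in _ = fine X]integral_mkcond; congr fine.
under [RHS]eq_integral do rewrite -hy.
rewrite (Fubini ih) [LHS]integral_mkcond; apply: eq_integral => x _.
rewrite (@hx x id)//= /gO !patchE; case: ifP => // _; last by rewrite mul0e.
rewrite muleC EFinM fineK// fin_num_measure//; exact: measurableI.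
Qed.

End finite_measure.
End fubini_cumulative.

Section cumulative.
Context {R : realType}.
Local Notation mR := (measurableTypeR R).
Local Notation leb := (@lebesgue_measure R).

Definition cumulative (nu : {charge set mR -> \bar R}) (a b x : R) : R :=
  fine (nu (`]a, b[ `&` `]-oo, x])).

Lemma measure_ray_measurable (m : {finite_measure set mR -> \bar R}) (a b : R) :
  measurable_fun setT (fun x : mR => fine (m (`]a, b[ `&` `]-oo, x]))).
Proof.
apply: nondecreasing_measurable => //.
move=> x y xy.
have mI z : measurable (`]a, b[ `&` `]-oo, z] : set mR) by exact: measurableI.
rewrite fine_le ?fin_num_measure//; try exact: mI.
apply: le_measure; rewrite ?inE; try exact: mI.
by apply: setIS => z /=; rewrite !in_itv /= => /le_trans; apply.
Qed.

Lemma measure_ray_le (m : {finite_measure set mR -> \bar R}) (a b x : R) :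
  `|fine (m (`]a, b[ `&` `]-oo, x]))| <= fine (m setT).
Proof.
have mI z : measurable (`]a, b[ `&` `]-oo, z] : set mR) by exact: measurableI.
rewrite ger0_norm ?fine_ge0// fine_le ?fin_num_measure//; try exact: mI.
by apply: le_measure; rewrite ?inE; try exact: mI.
Qed.

Section fixed_charge.
Variables (nu : {charge set mR -> \bar R}) (a b : R).
Let H := projT2 (cid (Hahn_pair nu)).

Lemma cumulativeE x : cumulative nu a b x =
  fine (jordan_pos H (`]a, b[ `&` `]-oo, x])) -
  fine (jordan_neg H (`]a, b[ `&` `]-oo, x])).
Proof.
have mI z : measurable (`]a, b[ `&` `]-oo, z] : set mR) by exact: measurableI.
rewrite /cumulative (jordan_decomp H (mI x)) /cadd /= cscaleN1 /=.
by rewrite fineB// fin_num_measure//; exact: mI.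
Qed.

Lemma measurable_cumulative : measurable_fun setT (cumulative nu a b : mR -> R).
Proof.
rewrite (funext cumulativeE : cumulative nu a b = _).
by apply: measurable_funB; exact: measure_ray_measurable.
Qed.

Lemma cumulative_bounded : exists K : R, forall x, `|cumulative nu a b x| <= K.
Proof.
exists (fine (jordan_pos H setT) + fine (jordan_neg H setT)) => x.
by rewrite cumulativeE (le_trans (ler_normB _ _))// lerD// measure_ray_le.
Qed.

(** Integration by parts with no regularity beyond integrability of g: [tail_integral b g] is the
    primitive of - g that vanishes at b. The measure version is applied to each Jordan part. *)
Lemma Rintegral_cumulative (g : mR -> R) :
  leb.-integrable (`]a, b[ : set mR) (EFin \o g) ->
  \int[leb]_(x in `]a, b[) (cumulative nu a b x * g x) =
  charge_integral nu `]a, b[%classic (tail_integral b g).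
Proof.
move=> ig.
have I (m : {finite_measure set mR -> \bar R}) : leb.-integrable (`]a, b[ : set mR)
    (EFin \o (fun x => fine (m (`]a, b[ `&` `]-oo, x])) * g x)).
  rewrite (_ : _ \o _ = EFin \o (fun x => g x * fine (m (`]a, b[ `&` `]-oo, x])))); last first.
    by apply/funext => x /=; rewrite mulrC.
  apply: (integrable_mul_bounded _ ig (K := fine (m setT))) => //.
    by apply: measurable_funTS; exact: measure_ray_measurable.
  by move=> x _; exact: measure_ray_le.
rewrite /charge_integral -/H -!Rintegral_cumulative_mul//.
rewrite -RintegralB//.
by apply: eq_Rintegral => x _; rewrite cumulativeE mulrBl.
Qed.
End fixed_charge.
End cumulative.

(** * The du Bois-Reymond lemma *)

Section du_bois_reymond.
Context {R : realType}.
Local Notation mR := (measurableTypeR R).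
Local Notation leb := (@lebesgue_measure R).

(** A primitive of a one-sided mollifier: its derivative lives on [s, s + e] and has integral 1. *)
Definition step_at (s e x : R) : R := smooth_step (e^-1 * x + - (e^-1 * s)).

Lemma step_at_smooth s e : smooth_alg (step_at s e).
Proof. exact: (smooth_affine _ _ smooth_step_smooth). Qed.

Lemma step_at_le s e x : 0 < e -> x <= s -> step_at s e x = 0.
Proof.
move=> e0 xs; apply: smooth_step_le0.
by rewrite -mulrBr pmulr_rle0 ?invr_gt0// subr_le0.
Qed.

Lemma step_at_ge s e x : 0 < e -> s + e <= x -> step_at s e x = 1.
Proof.
move=> e0 xs; apply: smooth_step_ge1.
by rewrite -mulrBr ler_pdivlMl// mulr1 lerBrDl.
Qed.

Lemma derive_step_at s e x :
  derive1 (step_at s e) x = e^-1 * derive1 smooth_step (e^-1 * x + - (e^-1 * s)).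
Proof.
set q := - (e^-1 * s).
have dS : is_derive (e^-1 * x + q) 1 smooth_step (derive1 smooth_step (e^-1 * x + q)).
  by rewrite derive1E; apply: derivableP; exact/smooth_alg_derivable/smooth_step_smooth.
rewrite derive1E; exact: (@derive_val _ _ _ _ _ _ _ (is_derive_comp_affine dS)).
Qed.

Lemma derive_step_at_out s e x : 0 < e -> ~~ (s <= x <= s + e) ->
  derive1 (step_at s e) x = 0.
Proof.
move=> e0 xse; rewrite derive_step_at derive_smooth_step_out ?mulr0//.
apply: contra xse; rewrite in_itv /= -mulrBr => /andP[h1 h2].
rewrite pmulr_rge0 ?invr_gt0// subr_ge0 in h1.
by rewrite ler_pdivrMl// mulr1 lerBlDl in h2; rewrite h1.
Qed.

Lemma step_at_test (a b s t e : R) : a < s -> a < t -> 0 < e -> s + e < b -> t + e < b ->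
  test_function `]a, b[%classic (fun x => step_at s e x - step_at t e x).
Proof.
move=> as_ at_ e0 sb tb; set phi := (fun x => step_at s e x - step_at t e x).
(* To the left of both s and t the two steps are 0, and past both s + e and t + e they are 1, so
   their difference vanishes. The points s and t come in either order. *)
have sub : closure [set x | phi x != 0] `<=` `[Num.min s t, Num.max s t + e]%classic.
  rewrite [X in _ `<=` X](closure_id _).1; last exact: interval_closed.
  apply: closure_subset => x /=; apply: contra_neqT; rewrite in_itv /= negb_and -!ltNge.
  rewrite lt_min addr_maxl gt_max => /orP[/andP[xs xt]|/andP[xs xt]].
    by rewrite /phi !step_at_le ?subrr// ltW.
  by rewrite /phi !step_at_ge ?subrr// ltW.
split.
- by move=> n x; apply: smooth_alg_derivable_n; apply: smoothB; exact: step_at_smooth.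
- apply: subclosed_compact sub; [exact: closed_closure|exact: segment_compact].
- move=> x /sub /=; rewrite !in_itv /= addr_maxl ge_min le_max => /andP[/orP h1 /orP h2].
  apply/andP; split; [case: h1 => h1|case: h2 => h2].
  + exact: lt_le_trans h1.
  + exact: lt_le_trans h1.
  + exact: le_lt_trans sb.
  + exact: le_lt_trans tb.
Qed.

Lemma cvg_mollification a b (w : R -> R) (s eta : R) : a < s < b ->
  leb.-integrable (`]a, b[ : set R) (EFin \o w) ->
  lebesgue_pt (w \_ `]a, b[) s -> 0 < eta ->
  \forall e \near 0^'+,
    `|\int[leb]_(x in `]a, b[) (w x * derive1 (step_at s e) x) - w s| <= eta.
Proof.
move=> /andP[as_ sb] iw ls eta0.
(* The kernel is bounded by K / e and carried by a ball of radius 2 e, hence the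
   error is at most 4 K times the mean oscillation of w over that ball. *)
have [K K0 SK] := @derive_smooth_step_bounded R.
have eta'0 : 0 < eta / (4 * K) by rewrite divr_gt0// mulr_gt0.
have [d /= d0 davg_lt] := ls _ (open_ereal_lt' (eta'0 : (0 < (eta / (4 * K))%:E)%E)).
near=> e.
have e0 : 0 < e by near: e; exact: nbhs_right_gt.
have ea : a < s - 2 * e.
  have : e < (s - a) / 2.
    by near: e; apply: nbhs_right_lt; rewrite divr_gt0// subr_gt0.
  lra.
have eb : s + 2 * e < b.
  have : e < (b - s) / 2.
    by near: e; apply: nbhs_right_lt; rewrite divr_gt0// subr_gt0.
  lra.
have ed : 2 * e < d.
  have : e < d / 2 by near: e; apply: nbhs_right_lt; rewrite divr_gt0.
  lra.
(* Radius 2 e rather than e, so that this open interval contains the closed interval [s, s + e] that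
   carries the kernel. *)
set B : set R := `]s - 2 * e, s + 2 * e[%classic.
have BO : B `<=` `]a, b[%classic.
  move=> x; rewrite /B /= !in_itv /= => /andP[/(lt_trans ea) -> /lt_trans]; exact.
set k := derive1 (step_at s e).
have kK x : `|k x| <= e^-1 * K.
  by rewrite /k derive_step_at normrM gtr0_norm ?invr_gt0// ler_pM2l ?invr_gt0.
have ck : continuous k.
  by apply: smooth_alg_continuous; apply: smooth_alg_derive1; exact: step_at_smooth.
have mB : measurable B by exact: measurable_itv.
have iwB : leb.-integrable B (EFin \o w) by apply: integrableS iw.
have iB (u : R -> R) : leb.-integrable B (EFin \o u) ->
    leb.-integrable B (EFin \o (fun x => u x * k x)).
  move=> iu; apply: (integrable_mul_bounded (K := e^-1 * K) _ iu) => //.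
  exact: continuous_measurable_itv.
have ic (c : R) : leb.-integrable B (EFin \o cst c).
  exact: (integrable_itv_bounded (K := `|c|)).
have -> : \int[leb]_(x in `]a, b[) (w x * k x) = \int[leb]_(x in B) (w x * k x).
  rewrite -[in RHS](setIidr BO) Rintegral_mkcondr; apply: eq_Rintegral => x _.
  rewrite patchE; case: ifPn => // xB.
  rewrite /k derive_step_at_out ?mulr0//; apply: contra xB => /andP[sx xs].
  rewrite inE /B /= in_itv /=; apply/andP; split; lra.
have k1 : \int[leb]_(x in B) k x = 1.
  have se : s - 2 * e <= s + 2 * e by lra.
  have dk x : derivable (step_at s e) x 1.
    by apply: smooth_alg_derivable; exact: step_at_smooth.
  have -> : \int[leb]_(x in B) k x = step_at s e (s + 2 * e) - step_at s e (s - 2 * e).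
    exact: Rintegral_itv_derive1 se dk ck.
  by rewrite step_at_ge ?step_at_le ?subr0//; lra.
have ik : leb.-integrable B (EFin \o k).
  by have := iB _ (ic 1); under eq_fun do rewrite /= mul1r.
have -> : w s = \int[leb]_(x in B) (w s * k x).
  by rewrite RintegralZl// k1 mulr1.
rewrite -RintegralB//; [|exact: iB|exact: (iB _ (ic (w s)))].
under eq_Rintegral do rewrite -mulrBl.
have iwB' : leb.-integrable B (EFin \o (fun x => w x - w s)).
  exact: (integrableB _ iwB (ic _)).
apply: le_trans (le_normr_Rintegral _ _) _ => //; first exact: iB.
have inB' := integrable_norm iwB'.
apply: (@le_trans _ _ (\int[leb]_(x in B) (e^-1 * K * `|w x - w s|))).
  apply: le_Rintegral => //.
  - exact: (integrable_norm (iB _ iwB')).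
  - exact: (integrableZl _ (e^-1 * K) inB').
  - by move=> x _; rewrite normrM mulrC ler_wpM2r.
rewrite RintegralZl//.
set I := Rintegral _ _ _.
have IE : (\int[leb]_(y in B) `|((center ((w \_ `]a, b[) s) \o w \_ `]a, b[) y)%:E| = I%:E)%E.
  rewrite /I /Rintegral fineK; last exact: (integrable_fin_num _ inB').
  apply: eq_integral => x /set_mem xB.
  have sO : `]a, b[%classic s by rewrite /= in_itv /= as_ sb.
  by rewrite /= !patchE (mem_set sO) (mem_set (BO x xB)).
have dE : davg (w \_ `]a, b[) s (2 * e) = ((4 * e)^-1 * I)%:E.
  transitivity ((((2 * e) *+ 2)%:E)^-1 * I%:E)%E.
    rewrite /davg /iavg lebesgue_measure_ball ?mulr_ge0 ?ltW// -IE.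
    by congr (_ * _)%E; congr integral; exact: ball_itv.
  rewrite inver mulrn_eq0 /= mulf_eq0 !gt_eqF//= -EFinM; congr (_^-1 * _)%:E.
  by rewrite -mulr_natl mulrA -natrM.
have := davg_lt (2 * e); rewrite /= sub0r normrN gtr0_norm ?mulr_gt0// => /(_ ed isT).
rewrite dE lte_fin ltr_pdivrMl ?mulr_gt0// => /ltW I_le.
rewrite -mulrA ler_pdivrMl// -ler_pdivlMl// (le_trans I_le)// le_eqVlt.
by apply/orP; left; apply/eqP; field; rewrite gt_eqF.
Unshelve. all: by end_near. Qed.

(** For Lebesgue points s and t, the derivative of the test function [step_at s e] - [step_at t e]
    is a difference of mollifiers; letting e tend to 0 in the hypothesis gives w s = w t. The
    constant is the value of w at one fixed Lebesgue point. *)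
Lemma du_bois_reymond a b (w : R -> R) : a < b ->
  leb.-integrable (`]a, b[ : set R) (EFin \o w) ->
  (forall phi, test_function `]a, b[%classic phi ->
     \int[leb]_(x in `]a, b[) (w x * derive1 phi x) = 0) ->
  exists C : R, {ae leb, forall x, a < x < b -> w x = C}.
Proof.
move=> ab iw w0.
have mO : measurable (`]a, b[ : set R) by exact: measurable_itv.
have lp := lebesgue_differentiation (integrable_locally_restrict mO iw).
have [s [sab ls]] : exists s, a < s < b /\ lebesgue_pt (w \_ `]a, b[) s.
  (* Without any Lebesgue point in ]a, b[, the whole interval would be null. *)
  apply: contrapT => nex; have [A [mA A0 AP]] := lp.
  have OA : `]a, b[%classic `<=` A.
    move=> x /=; rewrite in_itv /= => xab; apply: AP => /= lx.
    by apply: nex; exists x.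
  have := le_measure leb (mem_set mO) (mem_set mA) OA.
  rewrite [X in (_ <= X)%E]A0 [X in (X <= _)%E]lebesgue_measure_itv /= lte_fin ab.
  by rewrite -EFinD lee_fin subr_le0 leNgt ab.
exists (w s); apply: (@filterS _ _ (ae_filter_ringOfSetsType leb)) lp => t lt_ tab.
apply/eqP; rewrite -subr_eq0 -normr_le0; apply/ler_addgt0Pr => eta eta0.
rewrite add0r.
have eta20 : 0 < eta / 2 by rewrite divr_gt0.
have [[as_ sb] [at_ tb]] := (andP sab, andP tab).
have close x y : `|x - w s| <= eta / 2 -> `|y - w t| <= eta / 2 -> x - y = 0 ->
    `|w t - w s| <= eta.
  rewrite !ler_distl => /andP[? ?] /andP[? ?] ?.
  by apply/andP; split; lra.
near (0 : R)^'+ => e.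
have e0 : 0 < e by near: e; exact: nbhs_right_gt.
have hs : `|\int[leb]_(x in `]a, b[) (w x * derive1 (step_at s e) x) - w s| <= eta / 2.
  by near: e; exact: cvg_mollification.
have ht : `|\int[leb]_(x in `]a, b[) (w x * derive1 (step_at t e) x) - w t| <= eta / 2.
  by near: e; exact: cvg_mollification.
have : \int[leb]_(x in `]a, b[) (w x * derive1 (fun x => step_at s e x - step_at t e x) x) = 0.
  apply: w0; apply: step_at_test => //.
  - by rewrite -ltrBrDl; near: e; apply: nbhs_right_lt; rewrite subr_gt0.
  - by rewrite -ltrBrDl; near: e; apply: nbhs_right_lt; rewrite subr_gt0.
have -> : derive1 (fun x => step_at s e x - step_at t e x) =
   (fun x => derive1 (step_at s e) x - derive1 (step_at t e) x).
  apply/funext => x; rewrite !derive1E.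
  by rewrite deriveB//; exact/smooth_alg_derivable/step_at_smooth.
have ik r : leb.-integrable (`]a, b[ : set R) (EFin \o (fun x => w x * derive1 (step_at r e) x)).
  have ck : continuous (derive1 (step_at r e)).
    by apply: smooth_alg_continuous; apply: smooth_alg_derive1; exact: step_at_smooth.
  have [K kK] := continuous_itv_bounded ab ck.
  by apply: (integrable_mul_bounded _ iw _ kK) => //; exact: continuous_measurable_itv.
under eq_Rintegral do rewrite mulrBr.
rewrite RintegralB//.
exact: close hs ht.
Unshelve. all: by end_near. Qed.

End du_bois_reymond.

(** * Distributional derivatives *)

Section distributional_derivative.
Context {R : realType}.
Local Notation mR := (measurableTypeR R).
Local Notation leb := (@lebesgue_measure R).

Lemma distr_derivative_cumulative (a b : R) (u : R -> R) nu : a < b ->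
  leb.-integrable (`]a, b[ : set mR) (EFin \o u) ->
  is_distr_derivative `]a, b[%classic u nu ->
  exists C : R, {ae leb, forall x, a < x < b -> u x = cumulative nu a b x + C}.
Proof.
move=> ab iu [_ nuP].
have mO : measurable (`]a, b[ : set mR) by exact: measurable_itv.
have [K UK] := cumulative_bounded nu a b.
have iU : leb.-integrable (`]a, b[ : set mR) (EFin \o cumulative nu a b).
  apply: (integrable_itv_bounded (K := K)) => //.
  by apply: measurable_funTS; exact: measurable_cumulative.
have iw : leb.-integrable (`]a, b[ : set mR) (EFin \o (fun x => u x - cumulative nu a b x)).
  exact: (integrableB _ iu iU).
suff w0 phi : test_function `]a, b[%classic phi ->
    \int[leb]_(x in `]a, b[) ((u x - cumulative nu a b x) * derive1 phi x) = 0.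
  have [C CP] := du_bois_reymond ab iw w0.
  exists C; apply: (@filterS _ _ (ae_filter_ringOfSetsType leb)) CP => x xC /xC <-.
  by rewrite addrC subrK.
move=> tphi.
have cphi' := test_function_derive1_continuous tphi.
have [K' phi'K] := continuous_itv_bounded ab cphi'.
have [K0 phiK] := continuous_itv_bounded ab (test_function_continuous tphi).
have mphi' : measurable_fun (`]a, b[ : set mR) (derive1 phi).
  exact: continuous_measurable_itv.
have mphi : measurable_fun (`]a, b[ : set mR) phi.
  by apply: continuous_measurable_itv; exact: test_function_continuous tphi.
have i1 := integrable_mul_bounded mO iu mphi' phi'K.
have i2 := integrable_mul_bounded mO iU mphi' phi'K.
under eq_Rintegral do rewrite mulrBl.
rewrite RintegralB// nuP// Rintegral_cumulative; last first.
  exact: integrable_itv_bounded phi'K.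
(* As phi vanishes at b, the tail integral of phi' is - phi. Hence u and the cumulative function
   have the same integral against phi'. *)
have E x : x \in `]a, b[%classic -> tail_integral b (derive1 phi) x = -1 * phi x.
  by rewrite inE /= in_itv /= => xab; rewrite /tail_integral (Rintegral_test_derive1 tphi)// mulN1r.
have EI (m : {measure set mR -> \bar R}) :
    \int[m]_(x in `]a, b[) tail_integral b (derive1 phi) x =
    \int[m]_(x in `]a, b[) (-1 * phi x) by exact: eq_Rintegral.
rewrite /charge_integral !EI.
have I (m : {finite_measure set mR -> \bar R}) : m.-integrable (`]a, b[ : set mR) (EFin \o phi).
  by apply: fin_num_fun_integrable phiK => // A mA; exact: fin_num_measure.
rewrite !RintegralZl//; [lra|exact: I|exact: I].
Qed.

Section plateau.
Variables (s t : R).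

(** The shifts by 1 keep the function zero up to distance 1/(n + 1) inside either end, so its
    support is compact in the open interval ]s, t[; it equals 1 from distance 2/(n + 1) on. *)
Definition plateau (n : nat) (x : R) : R :=
  smooth_step (n.+1%:R * x + (- (n.+1%:R * s) - 1)) *
  smooth_step (- n.+1%:R * x + (n.+1%:R * t - 1)).

Lemma plateau_smooth n : smooth_alg (plateau n).
Proof. by apply: smoothM; apply: smooth_affine; exact: smooth_step_smooth. Qed.

Lemma plateau_out n x : x < s + n.+1%:R^-1 \/ t - n.+1%:R^-1 < x -> plateau n x = 0.
Proof.
have n0 : 0 < n.+1%:R :> R by [].
have nn : n.+1%:R * n.+1%:R^-1 = 1 :> R by rewrite divff.
rewrite /plateau => -[h|h].
  rewrite smooth_step_le0 ?mul0r//.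
  have := ltW h; rewrite -(ler_pM2l n0) mulrDr nn; lra.
rewrite [X in _ * X]smooth_step_le0 ?mulr0//.
have := ltW h; rewrite -(ler_pM2l n0) mulrBr nn; lra.
Qed.

Lemma plateau_in n x : s + 2 * n.+1%:R^-1 <= x <= t - 2 * n.+1%:R^-1 -> plateau n x = 1.
Proof.
have n0 : 0 < n.+1%:R :> R by [].
have nn : n.+1%:R * n.+1%:R^-1 = 1 :> R by rewrite divff.
move=> /andP[h1 h2]; rewrite -(ler_pM2l n0) mulrDr mulrCA nn in h1.
rewrite -(ler_pM2l n0) mulrBr mulrCA nn in h2.
by rewrite /plateau !smooth_step_ge1 ?mulr1//; lra.
Qed.

Lemma plateau_ge0 n x : 0 <= plateau n x.
Proof. by rewrite mulr_ge0 ?smooth_step_ge0. Qed.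

Lemma plateau_le1 n x : plateau n x <= 1.
Proof. by rewrite mulr_ile1 ?smooth_step_ge0 ?smooth_step_le1. Qed.

Lemma plateau_cvg x : plateau ^~ x @ \oo --> (\1_`]s, t[ x : R).
Proof.
rewrite indicE; case: (boolP (x \in _)) => [|/negP]; rewrite inE /= in_itv /=.
  move=> /andP[sx xt]; apply: cvg_near_cst.
  have d0 : 0 < Num.min (x - s) (t - x) by rewrite lt_min !subr_gt0 sx.
  have d20 : 0 < Num.min (x - s) (t - x) / 2 by rewrite divr_gt0.
  near=> n; apply: plateau_in.
  have : n.+1%:R^-1 < Num.min (x - s) (t - x) / 2.
    near: n; exact: (near_infty_natSinv_lt (PosNum d20)).
  set e := n.+1%:R^-1; rewrite ltr_pdivlMr// => /ltW.
  by rewrite le_min => /andP[h1 h2]; apply/andP; split; lra.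
move=> /negP; rewrite negb_and -!leNgt => h; rewrite [X in X @ _ --> _](_ : _ = cst 0).
  exact: cvg_cst.
apply/funext => n; have n0 : 0 < n.+1%:R^-1 :> R by rewrite invr_gt0.
by apply: plateau_out; case/orP: h => h; [left|right]; move: (_^-1) n0 => e e0; lra.
Unshelve. all: by end_near. Qed.

Lemma derive_plateau_out n x : ~~ (s < x < t) -> derive1 (plateau n) x = 0.
Proof.
move=> xst; have n0 : 0 < n.+1%:R^-1 :> R by rewrite invr_gt0.
rewrite derive1E (near_eq_derive (f := plateau n) (g := cst 0)) ?derive_cst//.
move: xst; rewrite negb_and -!leNgt => /orP[xs|tx]; near=> y; apply: plateau_out.
- by left; near: y; apply: lt_nbhsl; move: (_^-1) n0 => e e0; lra.
- by right; near: y; apply: lt_nbhsr; move: (_^-1) n0 => e e0; lra.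
Unshelve. all: by end_near. Qed.

Lemma plateau_test (a b : R) n : a <= s -> t <= b ->
  test_function `]a, b[%classic (plateau n).
Proof.
move=> as_ tb; have n0 : 0 < n.+1%:R^-1 :> R by rewrite invr_gt0.
have sub : closure [set x | plateau n x != 0] `<=`
    `[s + n.+1%:R^-1, t - n.+1%:R^-1]%classic.
  rewrite [X in _ `<=` X](closure_id _).1; last exact: interval_closed.
  apply: closure_subset => x /=; apply: contra_neqT; rewrite in_itv /= negb_and -!ltNge.
  by move=> /orP h; apply: plateau_out.
split.
- by move=> m x; apply: smooth_alg_derivable_n; exact: plateau_smooth.
- by apply: subclosed_compact sub; [exact: closed_closure|exact: segment_compact].
- move=> x /sub /=; rewrite !in_itv /= => /andP[].
  by move: (_^-1) n0 => e e0 h1 h2; apply/andP; split; lra.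
Qed.

Lemma plateau_integral_cvg (a b : R) (m : {finite_measure set mR -> \bar R}) :
  `]s, t[%classic `<=` `]a, b[%classic ->
  (fun n => \int[m]_(x in `]a, b[) (plateau n x)%:E)%E @ \oo --> m `]s, t[%classic.
Proof.
move=> stab; have mO : measurable (`]a, b[ : set mR) by exact: measurable_itv.
have -> : m `]s, t[%classic = (\int[m]_(x in `]a, b[) (\1_(`]s, t[%classic) x)%:E)%E.
  by rewrite integral_indic// (setIidl stab).
have [] := @dominated_convergence _ mR R m `]a, b[%classic mO
  (fun n x => (plateau n x)%:E) (fun x => (\1_(`]s, t[%classic) x)%:E) (cst 1%E) => //.
- move=> n; apply/measurable_EFinP; apply: continuous_measurable_itv.
  exact/smooth_alg_continuous/plateau_smooth.
- by apply/measurable_EFinP; exact: measurable_indic.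
- by apply: aeW => x _; apply: cvg_EFin; [exact: nearW|exact: plateau_cvg].
- exact: finite_measure_integrable_cst.
- apply: aeW => x n _ /=.
  by rewrite lee_fin ger0_norm ?plateau_ge0// plateau_le1.
Qed.

End plateau.

(** Open left rays are stable under intersection, generate the Borel sets and exhaust the line. *)
Lemma finite_measure_ray_unique (m1 m2 : {finite_measure set mR -> \bar R}) :
  (forall t : R, m1 `]-oo, t[%classic = m2 `]-oo, t[%classic) ->
  forall A, measurable A -> m1 A = m2 A.
Proof.
move=> m12 A mA; apply: (@measure_unique _ R mR (@RGenInftyO.G R)
  (fun k => `]-oo, k%:R[%classic) _ _ _ _ m1 m2) => //.
- exact: RGenInftyO.measurableE.
- move=> _ _ [x ->] [y ->]; exists (Num.min x y).
  by apply/seteqP; split=> z /=; rewrite !in_itv /= lt_min => /andP.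
- by move=> k; exists k%:R.
- apply/seteqP; split=> // x _; exists (Num.truncn `|x|).+1 => //=.
  by rewrite in_itv /= (le_lt_trans (ler_norm x))// truncnS_gt.
- by move=> _ [x ->]; exact: m12.
- by move=> k; rewrite -ge0_fin_numE// fin_num_measure//; exact: measurable_itv.
Qed.

(** Plateaus on a subinterval of ]l, r[ are test functions whose derivative is supported where u =
    k, so nu integrates them to zero and in the limit the two Jordan parts agree on the subinterval.
    They then agree on all Borel subsets of ]l, r[, and being carried by the disjoint sets P and N
    they both vanish there. *)
Lemma charge_total_variation_const (a b l r k : R) (u : R -> R) nu : a < b ->
  leb.-integrable (`]a, b[ : set mR) (EFin \o u) ->
  is_distr_derivative `]a, b[%classic u nu ->
  `]l, r[%classic `<=` `]a, b[%classic -> (forall x, l < x < r -> u x = k) ->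
  charge_total_variation nu `]l, r[%classic = 0%E.
Proof.
move=> ab iu [_ nuP] lrab uk.
have mO : measurable (`]a, b[ : set mR) by exact: measurable_itv.
have [lr|rl] := ltP l r; last first.
  by rewrite set_itv_ge ?measure0// bnd_simp -leNgt.
have al : a <= l.
  rewrite leNgt; apply/negP => la.
  (* If l < a, this point lies in ]l, r[ and to the left of a. *)
  have /lrab /= : `]l, r[%classic (Num.min ((l + a) / 2) ((l + r) / 2)).
    rewrite /= in_itv /= lt_min gt_min; apply/andP; split; first by apply/andP; split; lra.
    by apply/orP; right; lra.
  rewrite in_itv /= lt_min => /andP[/andP[? _] _]; lra.
have rb : r <= b.
  rewrite leNgt; apply/negP => br.
  have /lrab /= : `]l, r[%classic (Num.max ((b + r) / 2) ((l + r) / 2)).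
    rewrite /= in_itv /= gt_max lt_max; apply/andP; split; last by apply/andP; split; lra.
    by apply/orP; right; lra.
  rewrite in_itv /= gt_max => /andP[_ /andP[? _]]; lra.
set H := projT2 (cid (Hahn_pair nu)).
have jE s t : l <= s -> t <= r ->
    jordan_pos H `]s, t[%classic = jordan_neg H `]s, t[%classic.
  move=> ls tr.
  have stab : `]s, t[%classic `<=` `]a, b[%classic.
    by move=> x; rewrite /= !in_itv /= => /andP[? ?]; apply/andP; split; lra.
  have := @plateau_integral_cvg s t a b (jordan_neg H) stab.
  have := @plateau_integral_cvg s t a b (jordan_pos H) stab.
  (* The two sequences agree term by term: u may be replaced by k against plateau', whose integral
     over ]a, b[ is zero. *)
  rewrite [X in X @ _ --> _ -> _](_ : _ =
    (fun n => \int[jordan_neg H]_(x in `]a, b[) (plateau s t n x)%:E)%E); last first.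
    apply/funext => n.
    have tp : test_function `]a, b[%classic (plateau s t n) by apply: plateau_test; lra.
    have fI (m : {finite_measure set mR -> \bar R}) :
        m.-integrable (`]a, b[ : set mR) (EFin \o plateau s t n).
      have mp : measurable_fun (`]a, b[ : set mR) (plateau s t n).
        by apply: continuous_measurable_itv; exact: test_function_continuous tp.
      apply: (fin_num_fun_integrable _ mO mp (K := 1)).
        by move=> A mA; exact: fin_num_measure.
      by move=> x _; rewrite ger0_norm ?plateau_ge0// plateau_le1.
    have := nuP _ tp; rewrite (_ : \int[leb]_(x in _) _ = 0); last first.
      have -> : \int[leb]_(x in `]a, b[) (u x * derive1 (plateau s t n) x) =
                \int[leb]_(x in `]a, b[) (k * derive1 (plateau s t n) x).
        apply: eq_Rintegral => x _.
        case: (boolP (s < x < t)) => [/andP[sx xt]|xst].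
          by rewrite uk//; apply/andP; split; lra.
        by rewrite derive_plateau_out// !mulr0.
      have cp' := test_function_derive1_continuous tp.
      have [K' p'K] := continuous_itv_bounded ab cp'.
      have mp' : measurable_fun (`]a, b[ : set mR) (derive1 (plateau s t n)).
        exact: continuous_measurable_itv.
      rewrite RintegralZl//; last exact: integrable_itv_bounded p'K.
      rewrite (Rintegral_itv_derive1 _ _ (ltW ab) (test_function_derivable tp) cp').
      rewrite !(test_function_out tp) ?subrr ?mulr0//= in_itv /= ?ltxx ?andbF//.
    move=> /esym/eqP; rewrite oppr_eq0 subr_eq0 => /eqP E.
    rewrite -[LHS]fineK; last exact: integrable_fin_num (fI (jordan_pos H)).
    rewrite -[RHS]fineK; last exact: integrable_fin_num (fI (jordan_neg H)).
    by congr EFin.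
  by move=> /cvg_lim <-// /cvg_lim <-.
have mJ : measurable (`]l, r[ : set mR) by exact: measurable_itv.
(* Restricting both measures to ]l, r[ turns a ray into an interval ]l, min x r[, to which [jE]
   applies. *)
have restrE (m : {finite_measure set mR -> \bar R}) x :
    mrestr m mJ `]-oo, x[%classic = m `]l, Num.min x r[%classic.
  congr (m _); apply/seteqP; split=> z /=; rewrite !in_itv /= lt_min.
    by move=> [-> /andP[-> ->]].
  by move=> /andP[-> /andP[-> ->]].
have jA A : measurable A -> A `<=` `]l, r[%classic -> jordan_pos H A = jordan_neg H A.
  move=> mA Alr.
  have E (m : {finite_measure set mR -> \bar R}) : m A = mrestr m mJ A.
    by rewrite /mrestr (setIidl Alr).
  rewrite [LHS]E [RHS]E; apply: finite_measure_ray_unique => // t.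
  by rewrite [LHS]restrE [RHS]restrE; apply: jE; rewrite // ge_min lexx orbT.
set P := (projT1 (cid (Hahn_pair nu))).1; set N := (projT1 (cid (Hahn_pair nu))).2.
have [[mP _] [mN _] PNT PN0] : hahn_decomposition nu P N by exact: H.
suff [p0 n0] : jordan_pos H `]l, r[%classic = 0%E /\ jordan_neg H `]l, r[%classic = 0%E.
  by rewrite /charge_total_variation /= /charge_variation -/H p0 n0 adde0.
have pE A : measurable A -> jordan_pos H A = nu (A `&` P).
  by move=> mA; rewrite jordan_posE cjordan_posE /crestr0 mem_set.
have nE A : measurable A -> jordan_neg H A = (- nu (A `&` N))%E.
  by move=> mA; rewrite jordan_negE cjordan_negE /crestr0 mem_set.
suff p0 : jordan_pos H `]l, r[%classic = 0%E by split=> //; rewrite -jA.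
have mJP : measurable (`]l, r[ `&` P : set mR) by exact: measurableI.
(* The positive part is carried by P, where it equals the negative part, which sees only N. *)
have -> : jordan_pos H `]l, r[%classic = jordan_pos H (`]l, r[ `&` P).
  by rewrite !pE// -setIA setIid.
by rewrite jA ?nE// -?setIA ?PN0 ?setI0 ?charge0 ?oppe0.
Qed.

End distributional_derivative.

(** * The bound on tail integrals *)

Section oscillation_bound.
Context {R : realType}.
Local Notation mR := (measurableTypeR R).
Local Notation leb := (@lebesgue_measure R).

(** A is only enclosed in [p, q]: it will be a piece of some I_i whose ends are not given
    explicitly. *)
Lemma Rintegral_ae_bound (A : set mR) (g : mR -> R) (M p q : R) : measurable A ->
  leb.-integrable A (EFin \o g) -> {ae leb, forall x, A x -> `|g x| <= M} ->
  0 <= M -> p <= q -> A `<=` `[p, q]%classic ->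
  `|\int[leb]_(x in A) g x| <= M * (q - p).
Proof.
move=> mA ig gM M0 pq Apq; apply: le_trans (le_normr_Rintegral mA ig) _.
have ing := integrable_norm ig.
rewrite -lee_fin fineK; last exact: integrable_fin_num.
apply: le_trans (@integral_le_bound _ _ _ leb A (EFin \o g) M%:E mA _ _ _) _ => //.
- exact: measurable_int ig.
rewrite EFinM lee_wpmul2l ?lee_fin//.
have mpq : measurable (`[p, q]%classic : set mR) by exact: measurable_itv.
apply: le_trans (le_measure leb (mem_set mA) (mem_set mpq) Apq) _.
by rewrite [X in (X <= _)%E]lebesgue_measure_itv /= lte_fin; case: ltgtP pq => // ->; rewrite subrr.
Qed.

Section partition.
Variables (a b : R) (N : nat) (I : 'I_N -> set R).
Hypotheses (I_itv : forall i, is_interval (I i)) (I_disj : trivIset setT I)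
  (I_sorted : forall (i j : 'I_N) (x y : R), (i < j)%N -> I i x -> I j y -> x < y)
  (I_cover : \bigcup_i I i = `]a, b[%classic).

Lemma partition_sub i : I i `<=` `]a, b[%classic.
Proof. by rewrite -I_cover => x Ix; exists i. Qed.

Lemma Rintegral_partition (g : mR -> R) :
  leb.-integrable (`]a, b[ : set mR) (EFin \o g) ->
  \int[leb]_(x in `]a, b[) g x = \sum_(i < N) \int[leb]_(x in I i) g x.
Proof.
move=> ig; have mI i : measurable (I i : set mR) by exact: is_interval_measurable.
have cov : \big[setU/set0]_(i <- enum 'I_N) I i = `]a, b[%classic.
  rewrite -I_cover -bigcup_seq.
  by apply/seteqP; split=> x [i _ Ix]; exists i => //=; rewrite mem_enum.
rewrite /Rintegral -cov integral_bigsetU_EFin//=; last 3 first.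
- exact: enum_uniq.
- by apply: (sub_trivIset _ I_disj).
- by rewrite cov; exact: measurable_int ig.
rewrite big_enum /= (eq_bigr (fun i => (\int[leb]_(x in I i) g x)%:E)).
  by rewrite sumEFin.
move=> i _; rewrite fineK//; apply: integrable_fin_num => //.
by apply: integrableS ig => //; exact: partition_sub.
Qed.

(** Cells after i are integrated whole and contribute their zero mean; cells before i lie to the
    left of y. *)
Lemma tail_integral_partition (g : mR -> R) (i : 'I_N) (y : R) :
  leb.-integrable (`]a, b[ : set mR) (EFin \o g) ->
  (forall j, \int[leb]_(x in I j) g x = 0) -> I i y ->
  tail_integral b g y = \int[leb]_(x in I i `&` `[y, +oo[) g x.
Proof.
move=> ig g0 Iy.
have [ay yb] : a < y /\ y < b.
  by apply/andP; have := partition_sub Iy; rewrite /= in_itv.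
have my : measurable (`[y, +oo[ : set mR) by exact: measurable_itv.
have -> : tail_integral b g y = \int[leb]_(x in `]a, b[) (g \_ `[y, +oo[) x.
  rewrite -Rintegral_mkcondr; congr Rintegral; apply/seteqP; split=> x /=.
    by rewrite !in_itv /= andbT => /andP[yx ->]; rewrite (lt_le_trans ay yx).
  by rewrite !in_itv /= andbT => -[/andP[_ ->] ->].
rewrite Rintegral_partition; last first.
  rewrite -restrict_EFin; apply/integrable_restrict => //.
  by apply: integrableS ig => //; exact: measurableI.
rewrite (bigD1 i)//= big1 ?addr0 ?Rintegral_mkcondr// => j ji.
have [ij|ij] := ltnP i j.
  rewrite -[RHS](g0 j); apply: eq_Rintegral => x /set_mem Ix.
  by rewrite patchE mem_set//= in_itv /= andbT ltW// (I_sorted ij Iy Ix).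
have {}ij : (j < i)%N by rewrite ltn_neqAle ij andbT.
rewrite (_ : 0 = \int[leb]_(x in I j) cst 0 x); last first.
  by rewrite Rintegral_cst ?mul0r//; exact: is_interval_measurable.
apply: eq_Rintegral => x /set_mem Ix; rewrite patchE memNset//= in_itv /= andbT.
by apply/negP; rewrite -ltNge (I_sorted ij Ix Iy).
Qed.

Lemma tail_integral_bound (g alpha : mR -> R) (i : 'I_N) (M mu c d y : R) :
  leb.-integrable (`]a, b[ : set mR) (EFin \o g) ->
  (forall j, \int[leb]_(x in I j) g x = 0) ->
  {ae leb, forall x, a < x < b -> `|g x| <= M} -> 0 <= M -> M <= mu -> 0 < mu ->
  (forall x, I i x -> 0 <= alpha x) ->
  (forall x, I i x -> alpha x = - mu * `|x - c| + d) ->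
  I i y -> `|tail_integral b g y| <= alpha y.
Proof.
move=> ig g0 gM M0 Mmu mu0 al0 alE Iy.
rewrite (tail_integral_partition ig g0 Iy).
have mI : measurable (I i : set mR) by exact: is_interval_measurable.
(* The part of I i on the far side of y from c has length at most alpha y / mu. *)
have ay0 : 0 <= alpha y / mu by rewrite divr_ge0 ?al0// ltW.
have bound (A : set mR) p q : measurable A -> A `<=` I i -> p <= q ->
    A `<=` `[p, q]%classic -> q - p = alpha y / mu ->
    `|\int[leb]_(x in A) g x| <= alpha y.
  move=> mA AI pq Apq qp; apply: (@le_trans _ _ (M * (q - p))).
    apply: Rintegral_ae_bound => //.
      by apply: integrableS ig => //; exact: subset_trans (partition_sub (i := i)).
    apply: (@filterS _ _ (ae_filter_ringOfSetsType leb)) gM => x h Ax; apply: h.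
    by have := partition_sub (AI _ Ax); rewrite /= in_itv.
  by rewrite qp mulrCA ler_piMr ?al0// ler_pdivrMr ?mul1r.
have [yc|cy] := leP y c; last first.
  apply: (bound _ y (y + alpha y / mu)) => //; [|by rewrite lerDl|..].
  - by apply: measurableI => //; exact: measurable_itv.
  (* To the right of y > c, alpha decreases with slope mu, so alpha x >= 0 gives mu (x - y) <= alpha
     y. *)
  - move=> x /= [Ix]; rewrite !in_itv /= andbT => yx; rewrite yx /= -lerBlDl.
    rewrite ler_pdivlMr// mulrC.
    have := al0 _ Ix; rewrite (alE _ Ix) (alE _ Iy).
    rewrite !ger0_norm ?subr_ge0 ?(ltW cy)//; first lra.
    by rewrite (le_trans _ yx)// ltW.
  - lra.
have mlt : measurable (I i `&` `]-oo, y[ : set mR).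
  by apply: measurableI => //; exact: measurable_itv.
have mge : measurable (I i `&` `[y, +oo[ : set mR).
  by apply: measurableI => //; exact: measurable_itv.
(* For y <= c the short side is the left one, and the zero mean on I i exchanges the two sides up to
   sign. *)
have -> : \int[leb]_(x in I i `&` `[y, +oo[) g x =
        - \int[leb]_(x in I i `&` `]-oo, y[) g x.
  apply/eqP; rewrite -addr_eq0 addrC -Rintegral_setU//.
  - by rewrite -setIUr -itv_bndbnd_setU// set_itvNyy setIT g0.
  - rewrite -setIUr -itv_bndbnd_setU// set_itvNyy setIT.
    by apply: integrableS ig => //; exact: partition_sub.
  - apply/disj_setPS => x /= [[_]]; rewrite !in_itv /= andbT => xy [_].
    by rewrite leNgt xy.
rewrite normrN; apply: (bound _ (y - alpha y / mu) y) => //; [by rewrite gerBl|..].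
- move=> x /= [Ix]; rewrite !in_itv /= => /ltW xy; rewrite xy andbT lerBlDl -lerBlDr.
  rewrite ler_pdivlMr// mulrC.
  have := al0 _ Ix; rewrite (alE _ Ix) (alE _ Iy).
  rewrite !ler0_norm ?subr_le0//; first lra.
  exact: le_trans yc.
- lra.
Qed.

End partition.
End oscillation_bound.

(** * Step functions *)

Section step_functions.
Context {R : realType}.
Local Notation mR := (measurableTypeR R).
Local Notation leb := (@lebesgue_measure R).
Variables (a b : R) (N : nat) (I : 'I_N -> set R).
Hypotheses (ab : a < b) (I_itv : forall i, is_interval (I i))
  (I_nondeg : forall i, exists x y, [/\ I i x, I i y & x < y])
  (I_disj : trivIset setT I)
  (I_sorted : forall (i j : 'I_N) (x y : R), (i < j)%N -> I i x -> I j y -> x < y)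
  (I_cover : \bigcup_i I i = `]a, b[%classic).

Lemma step_functionE (v : 'I_N -> R) i x : I i x -> step_function I v x = v i.
Proof.
move=> Ix; rewrite /step_function (bigD1 i)//= indicE mem_set// mulr1 big1 ?addr0// => j ji.
rewrite indicE memNset ?mulr0// => Jx; move/eqP: ji; apply.
by apply: I_disj => //; exists x.
Qed.

Lemma BV_step_function (v : 'I_N -> R) : BV `]a, b[%classic (step_function I v).
Proof.
rewrite (_ : step_function I v = fun x => \sum_(i <- enum 'I_N) v i * \1_(I i) x); last first.
  by apply/funext => x; rewrite /step_function big_enum.
have BVi i : BV `]a, b[%classic (fun x => v i * \1_(I i) x).
  apply: BV_indic => //; last exact: (partition_sub I_cover).
  by have [x [y [Ix _ _]]] := I_nondeg i; exists x.
elim: (enum 'I_N) => [|i s ih].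
  have mab : `]a, b[%classic ((a + b) / 2) by rewrite /= in_itv /= !midf_lt.
  (* The empty sum is written as a multiple of the indicator of the whole interval, so that
     [BV_indic] covers the base case. *)
  rewrite [X in BV _ X](_ : _ = fun x : R => 0 * \1_(`]a, b[) x); last first.
    by apply/funext => x; rewrite big_nil mul0r.
  by apply: BV_indic => //; [exact: interval_is_interval|exists ((a + b) / 2)].
rewrite [X in BV _ X](_ : _ = fun x => v i * \1_(I i) x + \sum_(i <- s) v i * \1_(I i) x).
  exact: BV_add.
by apply/funext => x; rewrite big_cons.
Qed.

Let I_bounds i : has_lbound (I i) /\ has_ubound (I i).
Proof.
by split; [exists a|exists b] => x /(partition_sub I_cover);
  rewrite /= in_itv /= => /andP[/ltW ? /ltW].
Qed.

Let cover_pt x : a < x < b -> exists j, I j x.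
Proof.
move=> xab; have : `]a, b[%classic x by rewrite /= in_itv.
by rewrite -I_cover => -[j _ Ijx]; exists j.
Qed.

Section zero_at_breakpoints.
Variable alpha : R -> R.
Hypothesis alpha_sup : forall i : 'I_N, (i.+1 < N)%N -> alpha (sup (I i)) = 0.

(** Because x < b, the cover leaves points to the right of x, so i is not the last index and
    [alpha_sup] applies. *)
Lemma alpha_right_end i x : I i x -> (forall z, I i z -> z <= x) -> alpha x = 0.
Proof.
move=> Ix xmax; have [lbI ubI] := I_bounds i.
have sx : sup (I i) = x.
  apply/eqP; rewrite eq_le; apply/andP; split; last exact: ub_le_sup.
  by apply: ge_sup; [exists x|exact: xmax].
rewrite -sx; apply: alpha_sup; rewrite ltnNge; apply/negP => Ni.
have := partition_sub I_cover Ix; rewrite /= in_itv /= => /andP[ax xb].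
have [j Ij] : exists j, I j ((x + b) / 2) by apply: cover_pt; apply/andP; split; lra.
have [ij|ji|ij] := ltngtP i j.
- by have := ltn_ord j; rewrite ltnNge (leq_trans Ni).
- by have := I_sorted ji Ij Ix; lra.
- by have := xmax _; rewrite (val_inj ij) => /(_ _ Ij); lra.
Qed.

(** [alpha_sup] speaks of suprema only, so the minimum x of cell i has to be identified with the
    supremum of the cell just before it. That cell exists because points of ]a, x[ belong to cells
    of smaller index. *)
Lemma alpha_left_end i x : I i x -> (forall z, I i z -> x <= z) -> alpha x = 0.
Proof.
move=> Ix xmin.
have := partition_sub I_cover Ix; rewrite /= in_itv /= => /andP[ax xb].
have left_pt p : a < p < x -> exists2 j : 'I_N, (j < i)%N & I j p.
  move=> /andP[ap px].
  have [j Ij] : exists j, I j p by apply: cover_pt; rewrite ap (lt_trans px).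
  exists j => //; have [//|ij|ij] := ltngtP j i.
    by have := I_sorted ij Ix Ij; lra.
  by move: Ij; rewrite (val_inj ij) => /xmin; lra.
have [j ji Ij] : exists2 j : 'I_N, (j < i)%N & I j ((a + x) / 2).
  by apply: left_pt; apply/andP; split; lra.
have kN : (i.-1 < N)%N by rewrite (leq_ltn_trans (leq_pred i)).
pose k := Ordinal kN.
have ki : (k < i)%N by rewrite /= prednK// (leq_ltn_trans _ ji).
have [lbk ubk] := I_bounds k.
have [y [_ [Iy _ _]]] := I_nondeg k.
suff <- : sup (I k) = x.
  by apply: alpha_sup; rewrite /= prednK ?ltn_ord// (leq_ltn_trans _ ji).
apply/eqP; rewrite eq_le; apply/andP; split.
  by apply: ge_sup; [exists y|move=> z Iz; exact: ltW (I_sorted ki Iz Ix)].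
rewrite leNgt; apply/negP => sx.
(* A point in the supposed gap between sup (I k) and x, also to the right of a. It lies in a cell
   before i, yet neither in k nor before k, while no index lies strictly between k and i. *)
pose p := Num.max ((sup (I k) + x) / 2) ((a + x) / 2).
have sp : sup (I k) < p by rewrite /p lt_max; apply/orP; left; lra.
have [l li Il] : exists2 l : 'I_N, (l < i)%N & I l p.
  apply: left_pt; rewrite /p lt_max gt_max; apply/andP; split.
    by apply/orP; right; lra.
  by apply/andP; split; lra.
have ys : y <= sup (I k) by exact: ub_le_sup.
have [lk|kl|lk] := ltngtP l k.
- by have := I_sorted lk Il Iy; lra.
- by move: kl; rewrite /= ltnNge -ltnS prednK ?li// (leq_ltn_trans _ ji).
- by move: Il; rewrite (val_inj lk) => Ikp; have := ub_le_sup ubk Ikp; lra.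
Qed.

Lemma alpha_neq0_inside x : a < x < b -> alpha x != 0 ->
  exists i, inf (I i) < x < sup (I i).
Proof.
move=> /cover_pt [i Ix] ax0; exists i; have [lbI ubI] := I_bounds i.
have [z Iz zx] : exists2 z, I i z & z < x.
  apply: contrapT => nz; move/eqP: ax0; apply; apply: (alpha_left_end Ix) => z Iz.
  by rewrite leNgt; apply/negP => zx; apply: nz; exists z.
have [w Iw xw] : exists2 w, I i w & x < w.
  apply: contrapT => nw; move/eqP: ax0; apply; apply: (alpha_right_end Ix) => w Iw.
  by rewrite leNgt; apply/negP => xw; apply: nw; exists w.
rewrite (le_lt_trans (ge_inf lbI Iz) zx) /=.
by rewrite (lt_le_trans xw)// ub_le_sup.
Qed.

Lemma open_hull_sub i : `]inf (I i), sup (I i)[%classic `<=` I i.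
Proof.
move=> x; have [c0 [c1 IE]] := bounded_interval_itv (I_itv (i := i))
  (partition_sub I_cover (i := i)).
rewrite [X in _ -> X x]IE /= !in_itv /= => /andP[lx xr].
by apply/andP; split; [case: c0 {IE}|case: c1 {IE}]; rewrite /= ?lteifE ?lx ?xr ?ltW.
Qed.

(** [charge_total_variation_const] makes the open hulls of the cells null, and alpha vanishes at
    every point of ]a, b[ outside them, so the integrand is zero almost everywhere. *)
Lemma step_function_variation (v : 'I_N -> R) nu :
  is_distr_derivative `]a, b[%classic (step_function I v) nu ->
  measurable_fun (`]a, b[ : set mR) alpha ->
  (\int[charge_total_variation nu]_(x in `]a, b[) (alpha x)%:E = 0)%E.
Proof.
move=> nuP mal; set m := charge_total_variation nu.
have m0 i : m `]inf (I i), sup (I i)[%classic = 0%E.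
  apply: (charge_total_variation_const (k := v i) ab _ nuP) => //.
  - by have [] := BV_step_function v.
  - by move=> x /open_hull_sub; exact: (partition_sub I_cover).
  - by move=> x xi; apply: step_functionE; apply: open_hull_sub; rewrite /= in_itv.
have negl : m.-negligible (\bigcup_(i : 'I_N) `]inf (I i), sup (I i)[%classic).
  rewrite (_ : \bigcup_(i : 'I_N) _ =
      \big[setU/set0]_(i <- enum 'I_N) `]inf (I i), sup (I i)[%classic); last first.
    rewrite -bigcup_seq; apply/seteqP; split=> x [i _ Ix]; exists i => //=.
    by rewrite mem_enum.
  elim/big_ind : _ => [||i _]; [exact: negligible_set0| |].
    by move=> A B nA nB; apply: negligibleU.
  by exists `]inf (I i), sup (I i)[%classic; split => //; exact: measurable_itv.
rewrite -(integral0 m `]a, b[%classic).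
apply: ae_eq_integral => //.
- exact/measurable_EFinP.
- case: negl => A [mA A0 AP]; exists A; split => // x /= /not_implyP[xab].
  move=> /eqP; rewrite /= eqe => ax0; apply: AP.
  have [i] := alpha_neq0_inside (xab : a < x < b) ax0.
  by exists i => //=; rewrite in_itv.
Qed.

End zero_at_breakpoints.
End step_functions.

(** * Comparison of energies *)

Section energy_comparison.
Context {R : realType}.
Local Notation mR := (measurableTypeR R).
Local Notation leb := (@lebesgue_measure R).

Lemma distr_derivativeP (O : set R) (u : R -> R) : BV O u ->
  is_distr_derivative O u (distr_derivative O u).
Proof.
rewrite /distr_derivative => -[_ nuP]; case: pselect => // h.
exact: (projT2 (cid h)).
Qed.

(** The Jordan parts of nu come from a choice, so g is assumed integrable against every finite
    measure; [integrable_tail_integral] provides this for H. *)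
Lemma charge_integral_le_variation (nu : {charge set mR -> \bar R}) (O : set mR)
    (g alpha : mR -> R) : measurable O -> measurable_fun O alpha ->
  (forall m : {finite_measure set mR -> \bar R}, m.-integrable O (EFin \o g)) ->
  (forall x, O x -> `|g x| <= alpha x) ->
  ((charge_integral nu O g)%:E <=
     \int[charge_total_variation nu]_(x in O) (alpha x)%:E)%E.
Proof.
move=> mO mal ig gal.
have al0 x : O x -> (0 <= (alpha x)%:E)%E.
  by move=> Ox; rewrite lee_fin (le_trans _ (gal x Ox)).
have mal' : measurable_fun O (EFin \o alpha) by exact/measurable_EFinP.
set H := projT2 (cid (Hahn_pair nu)).
have -> : (\int[charge_total_variation nu]_(x in O) (alpha x)%:E =
    \int[jordan_pos H]_(x in O) (alpha x)%:E + \int[jordan_neg H]_(x in O) (alpha x)%:E)%E.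
  rewrite -ge0_integral_measure_add//; apply: eq_measure_integral => A mA _.
  by rewrite [RHS]measure_addE.
have le (m : {finite_measure set mR -> \bar R}) :
    ((`|\int[m]_(x in O) g x|)%:E <= \int[m]_(x in O) (alpha x)%:E)%E.
  apply: le_trans (_ : (\int[m]_(x in O) `|g x|)%:E <= _)%E.
    by rewrite lee_fin; exact: le_normr_Rintegral mO (ig m).
  rewrite fineK; last exact: integrable_fin_num (integrable_norm (ig m)).
  apply: ge0_le_integral => //.
  exact: measurable_int (integrable_norm (ig m)).
apply: le_trans (leeD (le (jordan_pos H)) (le (jordan_neg H))).
rewrite -EFinD lee_fin /charge_integral -/H.
by rewrite lerD// ?ler_norm// -normrN ler_norm.
Qed.

Lemma ae_conj (P Q : R -> Prop) : {ae leb, forall x, P x} -> {ae leb, forall x, Q x} ->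
  {ae leb, forall x, P x /\ Q x}.
Proof. by move=> p q; exact: (@filterI _ _ (ae_filter_ringOfSetsType leb)). Qed.

Lemma ae_sub (P Q : R -> Prop) : (forall x, P x -> Q x) ->
  {ae leb, forall x, P x} -> {ae leb, forall x, Q x}.
Proof. by move=> PQ; exact: (@filterS _ _ (ae_filter_ringOfSetsType leb)). Qed.

Lemma integrable_ae_bounded (a b : R) (g : mR -> R) (K : R) :
  measurable_fun (`]a, b[ : set mR) g -> 0 <= K ->
  {ae leb, forall x, a < x < b -> `|g x| <= K} ->
  leb.-integrable (`]a, b[ : set mR) (EFin \o g).
Proof.
move=> mg K0 gK; have mO : measurable (`]a, b[ : set mR) by exact: measurable_itv.
have mg' : measurable_fun (`]a, b[ : set mR) (EFin \o g) by exact/measurable_EFinP.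
apply/integrableP; split; first exact: mg'.
have K0' : (0 <= K%:E)%E by rewrite lee_fin.
have gK' : {ae leb, forall x, `]a, b[%classic x -> (`|(EFin \o g) x| <= K%:E)%E}.
  by apply: ae_sub gK => x h; rewrite /= in_itv.
apply: le_lt_trans (@integral_le_bound _ _ _ leb _ _ _ mO mg' K0' gK') _.
rewrite [X in (_ * X)%E]lebesgue_measure_itv /= lte_fin; case: ifP => ab.
  by rewrite -EFinB -EFinM ltry.
by rewrite mule0 ltry.
Qed.

(** In one dimension a BV function is a bounded cumulative function plus a constant. This
    boundedness makes all the products in the expansion of (f - u)^2 integrable. *)
Lemma BV_ae_bounded (a b : R) (u : R -> R) : a < b -> BV `]a, b[%classic u ->
  exists2 K : R, 0 <= K & {ae leb, forall x, a < x < b -> `|u x| <= K}.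
Proof.
move=> ab [iu [nu nuP]].
have [C uC] := distr_derivative_cumulative ab iu nuP.
have [K UK] := cumulative_bounded nu a b.
exists (K + `|C|); first by rewrite addr_ge0// (le_trans _ (UK 0)).
apply: ae_sub uC => x h /h ->.
by rewrite (le_trans (ler_normD _ _))// lerD2r.
Qed.

(** The additive constant between u and its cumulative function is killed by the zero mean of
    eta. *)
Lemma Rintegral_mul_BV (a b : R) (u eta : R -> R) nu : a < b ->
  leb.-integrable (`]a, b[ : set mR) (EFin \o u) ->
  is_distr_derivative `]a, b[%classic u nu ->
  leb.-integrable (`]a, b[ : set mR) (EFin \o eta) ->
  \int[leb]_(x in `]a, b[) eta x = 0 ->
  \int[leb]_(x in `]a, b[) (u x * eta x) =
  charge_integral nu `]a, b[%classic (tail_integral b eta).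
Proof.
move=> ab iu nuP ieta eta0.
have mO : measurable (`]a, b[ : set mR) by exact: measurable_itv.
have meta : measurable_fun (`]a, b[ : set mR) eta.
  by apply/measurable_EFinP; exact: measurable_int ieta.
have mu : measurable_fun (`]a, b[ : set mR) u.
  by apply/measurable_EFinP; exact: measurable_int iu.
have mU : measurable_fun (`]a, b[ : set mR) (cumulative nu a b).
  by apply: measurable_funTS; exact: measurable_cumulative.
have [C uC] := distr_derivative_cumulative ab iu nuP.
have [K UK] := cumulative_bounded nu a b.
rewrite -Rintegral_cumulative//.
have iU : leb.-integrable (`]a, b[ : set mR) (EFin \o (fun x => cumulative nu a b x * eta x)).
  have := integrable_mul_bounded mO ieta mU (fun x _ => UK x).
  by congr (is_true (integrable _ _ _)); apply/funext => x /=; rewrite mulrC.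
transitivity (\int[leb]_(x in `]a, b[) (cumulative nu a b x * eta x + C * eta x)).
  congr fine; apply: ae_eq_integral => //.
  - by apply/measurable_EFinP; exact: measurable_funM.
  - apply/measurable_EFinP; apply: measurable_funD; first exact: measurable_funM.
    exact: measurable_funM.
  - apply: ae_sub uC => x h; rewrite /= in_itv /= => /h ->.
    by rewrite mulrDl.
rewrite RintegralD//; last exact: (integrableZl _ C ieta).
by rewrite RintegralZl// eta0 mulr0 addr0.
Qed.

End energy_comparison.

(** * Optimality and uniqueness of the step function *)

Section optimality.
Context {R : realType}.
Local Notation mR := (measurableTypeR R).
Local Notation leb := (@lebesgue_measure R).

Lemma Linfty_norm_ae (a b : R) (f : R -> R) (M : R) : a < b ->
  (Linfty_norm `]a, b[%classic f <= M%:E)%E ->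
  {ae leb, forall x, a < x < b -> `|f x| <= M}.
Proof.
(* The norm unfolds to an essential supremum only on a space of positive measure. *)
move=> ab fM; have pos : (0 < leb setT)%E.
  have mO : measurable (`]a, b[%classic : set mR) by exact: measurable_itv.
  apply: lt_le_trans (le_measure leb (mem_set mO) (mem_set measurableT) _) => //.
  by rewrite [X in (_ < X)%E]lebesgue_measure_itv /= lte_fin ab -EFinB lte_fin subr_gt0.
move: fM; rewrite /Linfty_norm unlock pos => fM.
apply: ae_sub (ess_sup_ge leb (abse \o (EFin \o f) \_ `]a, b[)) => x h xab.
have xO : x \in `]a, b[%classic by rewrite inE /= in_itv.
by move: (le_trans h fM); rewrite /= patchE xO.
Qed.

Lemma Rintegral_partition_step (a b : R) (N : nat) (I : 'I_N -> set R) (v : 'I_N -> R)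
    (eta : R -> R) :
  (forall i, is_interval (I i)) -> trivIset setT I ->
  \bigcup_i I i = `]a, b[%classic ->
  leb.-integrable (`]a, b[ : set mR) (EFin \o eta) ->
  leb.-integrable (`]a, b[ : set mR) (EFin \o (fun x => step_function I v x * eta x)) ->
  (forall i, \int[leb]_(x in I i) eta x = 0) ->
  \int[leb]_(x in `]a, b[) (step_function I v x * eta x) = 0.
Proof.
move=> I_itv I_disj I_cover ieta iv eta0.
rewrite (Rintegral_partition I_itv I_disj I_cover iv) big1// => i _.
transitivity (\int[leb]_(x in I i) (v i * eta x)).
  by apply: eq_Rintegral => x /set_mem Ix; rewrite (step_functionE I_disj _ Ix).
rewrite RintegralZl ?eta0 ?mulr0//; first exact: is_interval_measurable.
apply: integrableS ieta => //; first exact: is_interval_measurable.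
exact: (partition_sub I_cover).
Qed.

(** Integrating f = k + eta over J gives k times the length of J, which is positive and can be
    cancelled. *)
Lemma step_coefficient_bound (a b : R) (J : set R) (k M : R) (f eta : R -> R) :
  is_interval J -> (exists x y, [/\ J x, J y & x < y]) -> J `<=` `]a, b[%classic ->
  leb.-integrable (`]a, b[ : set mR) (EFin \o eta) ->
  \int[leb]_(x in J) eta x = 0 -> (forall x, J x -> f x = k + eta x) ->
  {ae leb, forall x, a < x < b -> `|f x| <= M} -> 0 <= M -> `|k| <= M.
Proof.
move=> J_itv [x0 [y0 [Jx0 Jy0 xy0]]] Jab ieta eta0 fE fM M0.
have mJ : measurable (J : set mR) by exact: is_interval_measurable.
have [c0 [c1 JE]] := bounded_interval_itv J_itv Jab.
have lbJ : has_lbound J by exists a => x /Jab; rewrite /= in_itv /= => /andP[/ltW].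
have ubJ : has_ubound J by exists b => x /Jab; rewrite /= in_itv /= => /andP[_ /ltW].
have lr : inf J < sup J.
  by rewrite (le_lt_trans (ge_inf lbJ Jx0))// (lt_le_trans xy0)// ub_le_sup.
have Jlr : J `<=` `[inf J, sup J]%classic.
  by move=> x Jx; rewrite /= in_itv /= ge_inf//= ub_le_sup.
have lJ : leb J = (sup J - inf J)%:E.
  rewrite [in LHS]JE; apply: etrans (lebesgue_measure_itv _) _.
  by rewrite /= lte_fin lr EFinB.
have ik : leb.-integrable J (EFin \o cst k).
  apply: measurable_bounded_integrable => //; first by rewrite [X in (X < _)%E]lJ ltry.
  by exists `|k|; split=> [|M' kM' x _]; [exact: num_real|exact: ltW kM'].
have ietaJ : leb.-integrable J (EFin \o eta) by apply: integrableS ieta.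
have : `|\int[leb]_(x in J) f x| <= M * (sup J - inf J).
  apply: Rintegral_ae_bound => //.
  - apply: eq_integrable (integrableD _ ik ietaJ) => // x /set_mem Jx.
    by rewrite /= fE.
  - apply: ae_sub fM => x h Jx; apply: h.
    by have := Jab _ Jx; rewrite /= in_itv.
  - exact: ltW.
have -> : \int[leb]_(x in J) f x = \int[leb]_(x in J) (k + eta x).
  by apply: eq_Rintegral => x /set_mem /fE.
rewrite RintegralD// eta0 addr0 Rintegral_cst// [X in k * X](congr1 fine lJ) /= normrM.
by rewrite [X in _ * X]gtr0_norm ?subr_gt0// ler_pM2r ?subr_gt0.
Qed.

Section comparison.
Variables (a b : R) (eta f0 f alpha : R -> R) (M : R).
Hypotheses (ab : a < b) (eta_int : leb.-integrable (`]a, b[ : set mR) (EFin \o eta))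
  (M0 : 0 <= M) (eta_bound : {ae leb, forall x, a < x < b -> `|eta x| <= M})
  (eta0 : \int[leb]_(x in `]a, b[) eta x = 0)
  (BVf0 : BV `]a, b[%classic f0) (fE : f = fun x => f0 x + eta x)
  (f0eta : \int[leb]_(x in `]a, b[) (f0 x * eta x) = 0)
  (malpha : measurable_fun (`]a, b[ : set mR) alpha)
  (tail_le : forall y, `]a, b[%classic y -> `|tail_integral b eta y| <= alpha y).
Let O : set mR := `]a, b[%classic.

(** The gap term yields both minimality and uniqueness. The integrability claims come along because
    a real-valued integral defaults to 0 when it diverges, so its vanishing alone would say nothing
    about u. *)
Lemma energy_ge (u : R -> R) : BV `]a, b[%classic u ->
  [/\ leb.-integrable O (EFin \o (fun x => eta x ^+ 2)),
      leb.-integrable O (EFin \o (fun x => (u x - f0 x) ^+ 2)) &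
      ((2^-1 * \int[leb]_(x in O) (eta x ^+ 2) +
        2^-1 * \int[leb]_(x in O) ((u x - f0 x) ^+ 2))%:E <=
       energy `]a, b[%classic f alpha u)%E].
Proof.
move=> BVu; have mO : measurable O by exact: measurable_itv.
have [iu _] := BVu; have [if0 _] := BVf0.
have mfun (g : R -> R) : leb.-integrable O (EFin \o g) -> measurable_fun O g.
  by move=> ig; apply/measurable_EFinP; exact: measurable_int ig.
have [meta mu mf0] := And3 (mfun _ eta_int) (mfun _ iu) (mfun _ if0).
have [Ku Ku0 uK] := BV_ae_bounded ab BVu.
have [K0 K00 f0K] := BV_ae_bounded ab BVf0.
have muf0 : measurable_fun O (fun x => u x - f0 x) by exact: measurable_funB.
have ufK : {ae leb, forall x, a < x < b -> `|u x - f0 x| <= Ku + K0}.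
  apply: ae_sub (ae_conj uK f0K) => x [h1 h2] xab.
  by rewrite (le_trans (ler_normB _ _))// lerD ?h1 ?h2.
have prod (g h : R -> R) (A B : R) : measurable_fun O g -> measurable_fun O h ->
    0 <= A -> 0 <= B ->
    {ae leb, forall x, a < x < b -> `|g x| <= A} ->
    {ae leb, forall x, a < x < b -> `|h x| <= B} ->
    leb.-integrable O (EFin \o (fun x => g x * h x)).
  move=> mg mh A0 B0 gA hB; apply: (@integrable_ae_bounded _ _ _ _ (A * B)).
  - exact: measurable_funM.
  - exact: mulr_ge0.
  - by apply: ae_sub (ae_conj gA hB) => x [h1 h2] xab; rewrite normrM ler_pM ?h1 ?h2.
have KK0 : 0 <= Ku + K0 by rewrite addr_ge0.
have ieta2 := prod _ _ _ _ meta meta M0 M0 eta_bound eta_bound.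
have iv2 := prod _ _ _ _ muf0 muf0 KK0 KK0 ufK ufK.
have iueta := prod _ _ _ _ mu meta Ku0 M0 uK eta_bound.
have if0eta := prod _ _ _ _ mf0 meta K00 M0 f0K eta_bound.
have sqrE (g : R -> R) : (fun x => g x ^+ 2) = (fun x => g x * g x).
  by apply/funext => x; rewrite expr2.
(* Here z stands for \int u eta: the lower bound on the variation term pays for the cross term of
   the square. *)
have arith (x y z : R) : 2^-1 * x + 2^-1 * y = 2^-1 * (x + y - 2 * z) + z by field.
split; [by rewrite sqrE|by rewrite (sqrE (fun x => u x - f0 x))|].
have data : (\int[leb]_(x in O) ((f x - u x) ^+ 2)%:E =
    (\int[leb]_(x in O) (eta x ^+ 2) + \int[leb]_(x in O) ((u x - f0 x) ^+ 2)
     - 2 * \int[leb]_(x in O) (u x * eta x))%:E)%E.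
  have iS : leb.-integrable O (EFin \o (fun x => eta x * eta x + (u x - f0 x) * (u x - f0 x))).
    exact: (integrableD _ ieta2 iv2).
  have iU : leb.-integrable O (EFin \o (fun x => 2 * (u x * eta x))).
    exact: (integrableZl _ 2 iueta).
  have iF : leb.-integrable O (EFin \o (fun x => 2 * (f0 x * eta x))).
    exact: (integrableZl _ 2 if0eta).
  rewrite sqrE (sqrE (fun x => u x - f0 x)) -RintegralD//.
  rewrite -(RintegralZl _ _ iueta)// -RintegralB//.
  (* Adding 2 \int f_0 eta = 0 completes the cross term, so that the integrand becomes (f - u)^2. *)
  have -> : \int[leb]_(x in O) (eta x * eta x + (u x - f0 x) * (u x - f0 x) - 2 * (u x * eta x)) =
     \int[leb]_(x in O) (eta x * eta x + (u x - f0 x) * (u x - f0 x) - 2 * (u x * eta x))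
     + \int[leb]_(x in O) (2 * (f0 x * eta x)).
    by rewrite RintegralZl// f0eta mulr0 addr0.
  have iSU : leb.-integrable O (EFin \o (fun x =>
      eta x * eta x + (u x - f0 x) * (u x - f0 x) - 2 * (u x * eta x))).
    exact: (integrableB _ iS iU).
  rewrite -RintegralD// fineK; last exact: (integrable_fin_num _ (integrableD _ iSU iF)).
  apply: eq_integral => x _; congr EFin; rewrite fE.
  by move: (f0 x) (eta x) (u x) => p q r; ring.
rewrite /energy data.
have nuP := distr_derivativeP BVu.
have variation := charge_integral_le_variation (distr_derivative `]a, b[%classic u)
  mO malpha (fun m => integrable_tail_integral m eta_int) tail_le.
rewrite -(Rintegral_mul_BV ab iu nuP eta_int eta0) in variation.
apply: le_trans (leeD2l _ variation).
rewrite -EFinM -EFinD lee_fin le_eqVlt; apply/orP; left; apply/eqP; exact: arith.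
Qed.

End comparison.

End optimality.

Theorem proposition5p5 (R : realType) (a b : R) (hab : a < b)
    (N : nat) (I : 'I_N -> set R)
    (I_itv : forall i, is_interval (I i))
    (I_nondeg : forall i, exists x y, [/\ I i x, I i y & x < y])
    (I_disj : trivIset setT I)
    (I_sorted : forall (i j : 'I_N) (x y : R),
        (i < j)%N -> I i x -> I j y -> x < y)
    (I_cover : \bigcup_i I i = `]a, b[%classic)
    (fv : 'I_N -> R) (fv_inj : forall i j, i != j -> fv i != fv j)
    (eta : R -> R) (eta_BV : BV `]a, b[%classic eta)
    (eta_mean0 : forall i, \int[lebesgue_measure]_(x in I i) eta x = 0)
    (f0 f : R -> R)
    (f0E : f0 = step_function I fv)
    (fE : f = fun x => f0 x + eta x)
    (alpha : R -> R)
    (alpha_cont : {within `[a, b]%classic, continuous alpha})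
    (alpha_pwa : piecewise_affine a b alpha)
    (alpha_sup : forall i : 'I_N, (i.+1 < N)%N -> alpha (sup (I i)) = 0)
    (alpha_ge0 : forall x, a <= x <= b -> 0 <= alpha x)
    (mu c d : 'I_N -> R)
    (alphaE : forall (i : 'I_N) (x : R),
        I i x -> alpha x = - mu i * `|x - c i| + d i)
    (mu_gt : forall i, (2%:E * Linfty_norm `]a, b[%classic f < (mu i)%:E)%E) :
  BV_argmin `]a, b[%classic (energy `]a, b[%classic f alpha) f0 /\
  forall u, BV_argmin `]a, b[%classic (energy `]a, b[%classic f alpha) u ->
    {ae lebesgue_measure, forall x, a < x < b -> u x = f0 x}.
Proof.
have mO : measurable (`]a, b[ : set (measurableTypeR R)) by exact: measurable_itv.
(* The cover of a nonempty interval provides an index, and with it a real slope above 2 L. *)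
have [i0] : exists i : 'I_N, True.
  have : `]a, b[%classic ((a + b) / 2) by rewrite /= in_itv /= !midf_lt.
  by rewrite -I_cover => -[i _ _]; exists i.
move=> _; set L := Linfty_norm `]a, b[%classic f.
have L0 : (0 <= L)%E by exact: Lnorm_ge0.
(* If L were infinite, [mu_gt] would place the real number [mu i0] above +oo. *)
have Lfin : L \is a fin_num.
  rewrite ge0_fin_numE//; move: (mu_gt i0); rewrite -/L.
  case: L L0 => [r _ _|_|//]; first exact: ltry.
  by rewrite mulry gtr0_sg// mul1e.
have M0 : 0 <= fine L by exact: fine_ge0.
have mu_M i : 2 * fine L < mu i.
  by rewrite -lte_fin EFinM fineK//; exact: mu_gt.
have fM : {ae lebesgue_measure, forall x, a < x < b -> `|f x| <= fine L}.
  by apply: Linfty_norm_ae => //; rewrite fineK.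
have f0I i x : I i x -> f0 x = fv i by move=> Ix; rewrite f0E; exact: step_functionE.
have [ieta _] := eta_BV.
have fvM i : `|fv i| <= fine L.
  apply: (step_coefficient_bound (I_itv i) (I_nondeg i) _ ieta (eta_mean0 i) _ fM M0).
    exact: (partition_sub I_cover).
  by move=> x Ix; rewrite fE (f0I i).
have pt x : a < x < b -> exists i, I i x.
  move=> xab; have : `]a, b[%classic x by rewrite /= in_itv.
  by rewrite -I_cover => -[i _ Ix]; exists i.
(* The factor 2 in the slope condition arises here: one norm bounds f, the other its mean value on
   the cell. *)
have etaM : {ae lebesgue_measure, forall x, a < x < b -> `|eta x| <= 2 * fine L}.
  apply: ae_sub fM => x h xab; have [i Ix] := pt x xab.
  have -> : eta x = f x - fv i by rewrite fE (f0I i)// addrC addKr.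
  rewrite (le_trans (ler_normB _ _))//; have := h xab; have := fvM i; lra.
have M20 : 0 <= 2 * fine L by rewrite mulr_ge0.
have eta0 : \int[lebesgue_measure]_(x in `]a, b[) eta x = 0.
  by rewrite (Rintegral_partition I_itv I_disj I_cover ieta) big1.
have BVf0 : BV `]a, b[%classic f0.
  by rewrite f0E; exact: (BV_step_function hab I_itv I_nondeg I_cover).
have malpha : measurable_fun (`]a, b[ : set (measurableTypeR R)) alpha.
  apply: (@measurable_funS _ _ _ _ `[a, b]%classic) => //.
    exact: subset_itv_oo_cc.
  exact: subspace_continuous_measurable_fun.
have tail_le y : `]a, b[%classic y -> `|tail_integral b eta y| <= alpha y.
  rewrite /= in_itv /= => /pt[i Iy].
  apply: (tail_integral_bound I_itv I_disj I_sorted I_cover ieta eta_mean0 etaM M20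
    _ _ _ (alphaE i) Iy).
  - exact: ltW.
  - exact: le_lt_trans (mu_M i).
  - move=> x /(partition_sub I_cover); rewrite /= in_itv /= => /andP[ax xb].
    by apply: alpha_ge0; rewrite !ltW.
have f0eta : \int[lebesgue_measure]_(x in `]a, b[) (f0 x * eta x) = 0.
  rewrite f0E; apply: (Rintegral_partition_step I_itv I_disj I_cover ieta _ eta_mean0).
  have mf0 : measurable_fun (`]a, b[ : set (measurableTypeR R)) (step_function I fv).
    by rewrite -f0E; apply/measurable_EFinP; case: BVf0 => /measurable_int.
  have vM (x : R) : `]a, b[%classic x -> `|step_function I fv x| <= fine L.
    by rewrite /= in_itv /= => /pt[i Ix]; rewrite (step_functionE I_disj _ Ix).
  have := integrable_mul_bounded mO ieta mf0 vM.
  by congr (is_true (integrable _ _ _)); apply/funext => x /=; rewrite mulrC.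
have lower := energy_ge hab ieta M20 etaM eta0 BVf0 fE f0eta malpha tail_le.
have [ieta2 _ _] := lower _ BVf0.
set A := \int[lebesgue_measure]_(x in `]a, b[) (eta x ^+ 2).
have energy_f0 : energy `]a, b[%classic f alpha f0 = (2^-1 * A)%:E.
  rewrite /energy (step_function_variation (v := fv) hab I_itv I_nondeg I_disj
    I_sorted I_cover alpha_sup)//; last first.
    by rewrite -f0E; exact: distr_derivativeP.
  rewrite adde0 EFinM /A /Rintegral fineK; last exact: integrable_fin_num ieta2.
  by congr (_ * _)%E; apply: eq_integral => x _; rewrite fE addrC addKr.
have energy_min v : BV `]a, b[%classic v ->
    (energy `]a, b[%classic f alpha f0 <= energy `]a, b[%classic f alpha v)%E.
  move=> BVv; rewrite energy_f0; have [_ _ le_v] := lower _ BVv.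
  apply: (@le_trans _ _ _ _ _ _ le_v).
  by rewrite lee_fin lerDl mulr_ge0//; apply: Rintegral_ge0 => x _; exact: sqr_ge0.
split; first by exact: (conj BVf0 energy_min).
(* For a minimiser u the lower bound reads 1/2 A + 1/2 \int (u - f_0)^2 <= J u <= J f_0 = 1/2 A, so
   the gap vanishes. *)
move=> u [BVu /(_ _ BVf0)]; rewrite energy_f0 => Ju.
have [_ iv2 /le_trans/(_ Ju)] := lower _ BVu.
rewrite lee_fin gerDl pmulr_rle0 ?invr_gt0// => v2.
pose g (x : R) := (u x - f0 x) ^+ 2.
have mg : measurable_fun (`]a, b[ : set (measurableTypeR R)) (EFin \o g).
  exact: measurable_int iv2.
have g0 : (\int[lebesgue_measure]_(x in `]a, b[) `|(EFin \o g) x| = 0)%E.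
  apply/eqP; rewrite eq_le integral_ge0// andbT.
  under eq_integral do rewrite /= ger0_norm ?sqr_ge0//.
  by rewrite -[leLHS]fineK ?lee_fin//; exact: integrable_fin_num iv2.
have := (ae_eq_integral_abs lebesgue_measure mO mg).1 g0.
apply: ae_sub => x h xab; have xO : `]a, b[%classic x by rewrite /= in_itv.
by move: (h xO) => /eqP; rewrite /= eqe sqrf_eq0 subr_eq0 => /eqP.
Qed.
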